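(* Let $\mathcal{A}\in\mathbb{R}^{N\times N}$, $\mathcal{B}\in\mathbb{R}^{N\times P}$, $\mathcal{C}\in\mathbb{R}^{Q\times N}$ be such that the linear system $\dot\xi(t)=\mathcal{A}\xi(t)+\mathcal{B}u(t)$, $y(t)=\mathcal{C}\xi(t)$ is input-output stable. Let $\|\cdot\|$ denote the matrix norm induced by the vector $p$-norm for a fixed $p\in[1,\infty]$, and let $R=a\|\mathcal{A}\|$ for some $a>1$. Then for all $t\ge 0$ $$\|\mathcal{C}e^{t\mathcal{A}}\mathcal{B}\|\le \frac{1}{2\pi}\int_{-R}^{R}\|\mathcal{C}(i\omega I-\mathcal{A})^{-1}\mathcal{B}\|\,\mathrm{d}\omega+\frac{\|\mathcal{C}\|\,\|\mathcal{B}\|}{2-2a^{-1}}.$$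
   Context: The vector $p$-norms are $\|x\|_p=(\sum_k|x_k|^p)^{1/p}$ for $1\le p<\infty$ and $\|x\|_\infty=\max_k|x_k|$ for complex vectors; the induced matrix norm is $\|M\|=\sup_{\|x\|_p=1}\|Mx\|_p$ (same $p$ on domain and codomain). The transfer matrix $\mathcal{C}(sI-\mathcal{A})^{-1}\mathcal{B}$ is regarded as a matrix of rational functions of $s\in\mathbb{C}$ (so removable singularities at eigenvalues of $\mathcal{A}$ are removed). The system is called input-output stable if all poles of this transfer matrix lie in the open left half plane $\{\operatorname{Re} s<0\}$ ($\mathcal{A}$ itself may have other eigenvalues that are not poles of the transfer matrix). *)

(* Defs.v *)
From HB Require Import structures.
From mathcomp Require Import all_boot all_order all_algebra.
From mathcomp Require Import fraction generic_quotient complex.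
From mathcomp Require Import all_classical all_reals all_analysis.

Set Implicit Arguments.
Unset Strict Implicit.
Unset Printing Implicit Defensive.

Import Order.TTheory GRing.Theory Num.Theory.
Import numFieldNormedType.Exports.

Local Open Scope ring_scope.

Section PNorms.
Variable R : realType.

(* Only exponents p >= 1 are meaningful; -oo gets a dummy value. *)
Definition pnorm (p : \bar R) n (x : 'cV[R[i]]_n) : R :=
  match p with
  | q%:E%E => (\sum_(k < n) Normc.normc (x k 0) `^ q) `^ q^-1
  | +oo%E => \big[Num.max/0]_(k < n) Normc.normc (x k 0)
  | -oo%E => 0
  end.

Definition mxpnorm (p : \bar R) m n (M : 'M[R[i]]_(m, n)) : R :=
  sup [set pnorm p (M *m x) | x in [set x : 'cV[R[i]]_n | pnorm p x = 1]]%classic.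

(* The induced norm of a real matrix is that of its action on complex
   vectors. *)
Definition complex_mx m n (M : 'M[R]_(m, n)) : 'M[R[i]]_(m, n) :=
  map_mx (real_complex R) M.

End PNorms.

Definition expmx (R : realType) n (M : 'M[R]_n) : 'M[R]_n :=
  limn (series (fun k : nat => k`!%:R^-1 *: M ^+ k)).

Section RationalFunctions.
Variable K : fieldType.
Implicit Types f : {fraction {poly K}}.

(* f = ratfun_num f / ratfun_den f in lowest terms: the gcd of an arbitrary
   representative numerator / denominator is cancelled, so removable
   singularities disappear. *)
Definition ratfun_gcd f : {poly K} := gcdp (frac (repr f)).1 (frac (repr f)).2.
Definition ratfun_num f : {poly K} := (frac (repr f)).1 %/ ratfun_gcd f.
Definition ratfun_den f : {poly K} := (frac (repr f)).2 %/ ratfun_gcd f.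

Definition ratfun_pole f (s : K) : bool := root (ratfun_den f) s.

(* Meaningful only when s is not a pole of f. *)
Definition ratfun_eval f (s : K) : K := (ratfun_num f).[s] / (ratfun_den f).[s].

End RationalFunctions.

Definition const_ratfun_mx (K : fieldType) m n (M : 'M[K]_(m, n)) :
    'M[{fraction {poly K}}]_(m, n) :=
  map_mx (@tofrac _ \o @polyC K) M.

Section LinearSystems.
Variables (R : realType) (N P Q : nat).
Variables (A : 'M[R]_N) (B : 'M[R]_(N, P)) (C : 'M[R]_(Q, N)).

(* C (s I - A)^-1 B over the field of rational functions, 'X being s; the
   matrix s I - A is always invertible over that field. *)
Definition transfer_mx : 'M[{fraction {poly R[i]}}]_(Q, P) :=
  const_ratfun_mx (complex_mx C)
    *m invmx ((tofrac 'X)%:M - const_ratfun_mx (complex_mx A))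
    *m const_ratfun_mx (complex_mx B).

Definition transfer_at (s : R[i]) : 'M[R[i]]_(Q, P) :=
  map_mx (fun f => ratfun_eval f s) transfer_mx.

(* A pole of a matrix of rational functions is a pole of one of its entries. *)
Definition transfer_pole (s : R[i]) : Prop :=
  exists i j, ratfun_pole (transfer_mx i j) s.

Definition io_stable : Prop :=
  forall s : R[i], transfer_pole s -> complex.Re s < 0.

End LinearSystems.

(* Main.v *)
Require Import Defs.
From HB Require Import structures.
From mathcomp Require Import all_boot all_order all_algebra.
From mathcomp Require Import fraction generic_quotient complex.
From mathcomp Require Import all_classical all_reals all_analysis.
From mathcomp Require Import ring lra.

(** The idea is to write C exp(tA) B as a contour integral.  Since the norm of A
    bounds its spectrum, for r > ||A||
      2 pi i C exp(tA) B = int_Gamma exp(ts) C (s - A)^-1 B ds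
    over the circle Gamma of radius r.  On the left half circle exp(ts) has
    modulus at most 1 and the Neumann series bounds the resolvent by
    1 / (r - ||A||); the length pi r then gives, for r = a ||A||, the term
    ||C|| ||B|| / (2 - 2 / a).  On the right half circle the integrand is the
    transfer matrix times exp(ts), which by stability has no pole in the closed
    right half plane.  Cauchy's theorem moves that arc to the diameter, which
    gives the integral over the imaginary axis.

    The argument is made elementary in three ways.

    - exp(ts) is replaced by the polynomials q(s) = (1 + ts/n)^n.  On the left
      half disc they are bounded by exp((tr)^2/n) ([euler_poly_le]), and q(A)
      tends to exp(tA) ([expmx_entry_approx]).

    - No contour integral is formed: all integrands have explicit primitives.
      On the circle the resolvent is replaced by a partial Neumann series, so
      that the integrand is a Laurent polynomial whose primitive is known
      ([circle_prim]); its increase over a full turn is the residue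
      ([circle_prim_turn]).  On the right half disc the transfer matrix is a
      uniform limit of polynomials ([poly_approximable_ratio]): it suffices to
      treat 1 / (s - l) with Re l < 0, by a geometric series centred far out on
      the positive real axis.  A polynomial has a primitive, whose increase
      between -ir and ir does not depend on the path.

    - Norms of integrals are estimated by the mean value inequality for curves
      in a space of matrices ([mean_value_inequality]), with the primitive of
      a bound for the speed as the majorant.

    Together these give [contour_estimate] for polynomials, and in the limit
    [semigroup_estimate].  If ||A|| = 0 the radius a ||A|| is 0 and there is no
    circle; letting positive radii tend to 0 gives the result. *)

Set Implicit Arguments.
Unset Strict Implicit.
Unset Printing Implicit Defensive.

Import Order.TTheory GRing.Theory Num.Theory.
Import numFieldNormedType.Exports.

Local Open Scope ring_scope.

(** * Complex modulus *)

Section Modulus.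
Variable R : realType.
Implicit Types z w : R[i].
Local Notation normc := (@Normc.normc R).

Lemma normc_ge0 z : 0 <= normc z.
Proof. by case: z => a b; exact: sqrtr_ge0. Qed.

Lemma normc_gt0 z : z != 0 -> 0 < normc z.
Proof.
move=> z0; rewrite lt_neqAle normc_ge0 andbT eq_sym.
by apply: contra z0 => /eqP/Normc.eq0_normc ->.
Qed.

Lemma normc_real (x : R) : normc (real_complex R x) = `|x|.
Proof. by rewrite /Normc.normc /= expr0n addr0 sqrtr_sqr. Qed.

Lemma normc_i (x : R) : normc (Complex 0 x) = `|x|.
Proof. by rewrite /Normc.normc /= expr0n add0r sqrtr_sqr. Qed.

Lemma normcX z k : normc (z ^+ k) = normc z ^+ k.
Proof.
by elim: k => [|k IH]; rewrite ?expr0 ?Normc.normc1// !exprS Normc.normcM IH.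
Qed.

Lemma normc_sum I (r : seq I) (P : pred I) (F : I -> R[i]) :
  normc (\sum_(i <- r | P i) F i) <= \sum_(i <- r | P i) normc (F i).
Proof.
apply: (big_ind2 (fun z x => normc z <= x)) => //.
  by rewrite Normc.normc0.
by move=> x a y b xa yb; apply: le_trans (lerD xa yb); exact: le_normcD.
Qed.

Lemma normc_le_ReIm z : normc z <= `|complex.Re z| + `|complex.Im z|.
Proof.
case: z => a b /=; rewrite -[leRHS]ger0_norm ?addr_ge0// -sqrtr_sqr.
rewrite ler_sqrt ?sqr_ge0// sqrrD !real_normK ?num_real//.
by rewrite lerD2r lerDl mulrn_wge0// mulr_ge0.
Qed.

Lemma normc_sqr z : normc z ^+ 2 = complex.Re z ^+ 2 + complex.Im z ^+ 2.
Proof. by case: z => a b /=; rewrite sqr_sqrtr// addr_ge0// sqr_ge0. Qed.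

Lemma Re_le_normc z : `|complex.Re z| <= normc z.
Proof.
rewrite -ler_sqr ?nnegrE ?normc_ge0// normc_sqr real_normK ?num_real//.
by rewrite lerDl sqr_ge0.
Qed.

End Modulus.

(** * Vector p-norms and the matrix norms they induce *)

Section PNormTheory.
Variable R : realType.
Local Notation C := R[i].
Local Notation normc := (@Normc.normc R).

Section VectorNorm.
Variables (p : \bar R) (p_ge1 : (1 <= p)%E) (n : nat).
Implicit Types x y : 'cV[C]_n.

Lemma pnorm_ge0 x : 0 <= pnorm p x.
Proof.
by case: p => [q||] //=; [exact: powR_ge0|exact: bigmax_ge_id].
Qed.

Lemma powR_convex (q w1 w2 a b : R) : 1 <= q -> 0 <= w1 -> 0 <= w2 ->
  w1 + w2 = 1 -> 0 <= a -> 0 <= b ->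
  (w1 * a + w2 * b) `^ q <= w1 * a `^ q + w2 * b `^ q.
Proof.
move=> q1 w10 w20 w12 a0 b0; have w11 : w1 <= 1 by rewrite -w12 lerDl.
have {w12} -> : w2 = 1 - w1 by rewrite -w12 addrC addKr.
by apply: (convex_powR q1 (Itv01 w10 w11)); rewrite !inE /= in_itv /= andbT.
Qed.

Lemma powR_sum_pnorm (q : R) x : 1 <= q ->
  \sum_(k < n) normc (x k 0) `^ q = pnorm q%:E x `^ q.
Proof.
move=> q1 /=; rewrite -powRrM mulVf ?gt_eqF ?(lt_le_trans _ q1)// powRr1//.
by apply: sumr_ge0 => k _; exact: powR_ge0.
Qed.

Lemma pnorm_le_powR (q b : R) x : 1 <= q -> 0 <= b ->
  \sum_(k < n) normc (x k 0) `^ q <= b `^ q -> pnorm q%:E x <= b.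
Proof.
move=> q1 b0 h /=; have q0 : 0 < q by rewrite (lt_le_trans _ q1).
rewrite -[leRHS]powRr1// -[in leRHS](@divff _ q) ?gt_eqF// powRrM.
by apply: ge0_ler_powR; rewrite ?nnegrE ?invr_ge0 ?(ltW q0) ?powR_ge0//;
   apply: sumr_ge0 => k _; exact: powR_ge0.
Qed.

Lemma normc_le_pnorm x k : normc (x k 0) <= pnorm p x.
Proof.
case: p p_ge1 => [q q1|_|//] /=; last first.
  by rewrite (le_bigmax _ (fun k => normc (x k 0))).
rewrite lee_fin in q1; have q0 : 0 < q by rewrite (lt_le_trans _ q1).
rewrite -[leLHS]powRr1 ?normc_ge0// -[in leLHS](@divff _ q) ?gt_eqF// powRrM.
apply: ge0_ler_powR; rewrite ?nnegrE ?invr_ge0 ?(ltW q0) ?powR_ge0//.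
  by apply: sumr_ge0 => j _; exact: powR_ge0.
rewrite (bigD1 k)//= lerDl; apply: sumr_ge0 => j _; exact: powR_ge0.
Qed.

Lemma pnorm0_eq0 x : pnorm p x = 0 -> x = 0.
Proof.
move=> x0; apply/matrixP => i j; rewrite (ord1 j) mxE.
apply: Normc.eq0_normc; apply/eqP; rewrite eq_le normc_ge0 andbT.
by rewrite -x0; exact: normc_le_pnorm.
Qed.

Lemma pnorm_le_sum x : pnorm p x <= \sum_(k < n) normc (x k 0).
Proof.
set s := \sum_(k < n) _; have s0 : 0 <= s.
  by apply: sumr_ge0 => k _; exact: normc_ge0.
have xs k : normc (x k 0) <= s.
  rewrite /s (bigD1 k)//= lerDl; apply: sumr_ge0 => j _; exact: normc_ge0.
case: p p_ge1 => [q q1|_|//]; last by apply: bigmax_le.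
rewrite lee_fin in q1; apply: pnorm_le_powR => //.
have powE (u : R) : 0 <= u -> u `^ q = u * u `^ (q - 1).
  by move=> u0; rewrite -{2}(powRr1 u0) -powRD ?subrKC ?(gt_eqF (lt_le_trans ltr01 q1)).
rewrite [leRHS]powE// mulr_suml; apply: ler_sum => k _.
rewrite powE ?normc_ge0// ler_wpM2l ?normc_ge0//.
by apply: ge0_ler_powR; rewrite ?nnegrE ?normc_ge0 ?subr_ge0.
Qed.

Lemma pnormZ c x : pnorm p (c *: x) = normc c * pnorm p x.
Proof.
case: p p_ge1 => [q q1|_|//] /=; last first.
  under eq_bigr do rewrite mxE Normc.normcM.
  rewrite [RHS]mulrC; apply: (big_ind2 (fun a b => a = b * normc c)).
  - by rewrite mul0r.
  - by move=> _ a _ b -> ->; rewrite maxr_pMl ?normc_ge0.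
  - by move=> k _; rewrite mulrC.
rewrite lee_fin in q1; have q0 : q != 0 by rewrite gt_eqF ?(lt_le_trans _ q1).
under eq_bigr do rewrite mxE Normc.normcM powRM ?normc_ge0//.
rewrite -mulr_sumr powRM ?powR_ge0//; last first.
  by apply: sumr_ge0 => k _; exact: powR_ge0.
by rewrite -powRrM divff// powRr1 ?normc_ge0.
Qed.

(** Minkowski's inequality is convexity of the unit ball: the normalised
    vectors are averaged with weights proportional to the norms. *)
Lemma pnormD x y : pnorm p (x + y) <= pnorm p x + pnorm p y.
Proof.
have [x0|x0] := eqVneq (pnorm p x) 0.
  by rewrite x0 (pnorm0_eq0 x0) !add0r.
have [y0|y0] := eqVneq (pnorm p y) 0.
  by rewrite y0 (pnorm0_eq0 y0) !addr0.
have {}x0 : 0 < pnorm p x by rewrite lt_neqAle eq_sym x0 pnorm_ge0.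
have {}y0 : 0 < pnorm p y by rewrite lt_neqAle eq_sym y0 pnorm_ge0.
case: p p_ge1 x0 y0 => [q q1|_|//] x0 y0; last first.
  apply: bigmax_le => [|k _]; first by rewrite ltW// addr_gt0.
  rewrite mxE; apply: le_trans (le_normcD _ _) _.
  by apply: lerD; rewrite (le_bigmax _ (fun k => normc (_ k 0))).
rewrite lee_fin in q1.
have unitS (z : 'cV[C]_n) : 0 < pnorm q%:E z ->
    \sum_(k < n) (normc (z k 0) / pnorm q%:E z) `^ q = 1.
  move=> z0; under eq_bigr do rewrite powRM ?normc_ge0 ?invr_ge0 ?(ltW z0)//.
  rewrite -mulr_suml powR_sum_pnorm// -powRM ?(ltW z0) ?invr_ge0 ?(ltW z0)//.
  by rewrite divff ?gt_eqF// powR1.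
have := unitS _ x0; have := unitS _ y0.
have := @pnorm_le_powR q (pnorm q%:E x + pnorm q%:E y) (x + y) q1.
move: (pnorm q%:E x) (pnorm q%:E y) x0 y0 => a b x0 y0 le_powR unit_y unit_x.
have s0 : 0 < a + b by exact: addr_gt0.
apply: le_powR; first exact: ltW.
have w12 : a / (a + b) + b / (a + b) = 1 by rewrite -mulrDl divff ?gt_eqF.
have xyk k : normc ((x + y) k 0) `^ q <= (a + b) `^ q *
   (a / (a + b) * (normc (x k 0) / a) `^ q + b / (a + b) * (normc (y k 0) / b) `^ q).
  have w10 : 0 <= a / (a + b) by rewrite divr_ge0 ?(ltW x0) ?(ltW s0).
  have w20 : 0 <= b / (a + b) by rewrite divr_ge0 ?(ltW y0) ?(ltW s0).
  have cvx := powR_convex q1 w10 w20 w12 (divr_ge0 (normc_ge0 (x k 0)) (ltW x0))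
    (divr_ge0 (normc_ge0 (y k 0)) (ltW y0)).
  apply: le_trans (ler_wpM2l (powR_ge0 _ _) cvx).
  rewrite -powRM ?(ltW s0)//; last first.
    by rewrite addr_ge0// mulr_ge0 ?divr_ge0 ?normc_ge0 ?(ltW x0) ?(ltW y0) ?(ltW s0).
  have -> : (a + b) * (a / (a + b) * (normc (x k 0) / a) + b / (a + b) * (normc (y k 0) / b))
    = normc (x k 0) + normc (y k 0).
    by field; rewrite !gt_eqF.
  rewrite mxE; apply: ge0_ler_powR; rewrite ?nnegrE ?normc_ge0 ?addr_ge0 ?normc_ge0//.
    by rewrite (le_trans _ q1).
  exact: le_normcD.
apply: le_trans (ler_sum _ (fun k _ => xyk k)) _.
rewrite -mulr_sumr -[leRHS]mulr1 ler_wpM2l ?powR_ge0//.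
rewrite big_split /= -!mulr_sumr.
by rewrite unit_x unit_y !mulr1 -mulrDl divff ?gt_eqF.
Qed.

End VectorNorm.

Section MatrixNorm.
Variables (p : \bar R) (p_ge1 : (1 <= p)%E).
Local Notation nu := (mxpnorm p).

(** Crude, but it shows that the supremum defining the induced norm is taken
    over a bounded set, and later that entrywise convergence is convergence in
    norm. *)
Lemma pnorm_mulmx_le_sum m n (M : 'M[C]_(m, n)) (x : 'cV[C]_n) :
  pnorm p (M *m x) <= (\sum_(i < m) \sum_(j < n) normc (M i j)) * pnorm p x.
Proof.
apply: le_trans (pnorm_le_sum p_ge1 _) _; rewrite mulr_suml.
apply: ler_sum => i _; rewrite mxE mulr_suml.
apply: le_trans (normc_sum _ _ _) _; apply: ler_sum => j _.
by rewrite Normc.normcM ler_wpM2l ?normc_ge0// normc_le_pnorm.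
Qed.

Lemma mxpnorm_le m n (M : 'M[C]_(m, n)) (b : R) : 0 <= b ->
  (forall x, pnorm p x = 1 -> pnorm p (M *m x) <= b) -> nu M <= b.
Proof.
move=> b0 Mb; rewrite /mxpnorm.
set S := (X in sup X); have [->|S0] := eqVneq S set0; first by rewrite sup0.
apply: ge_sup; first exact/set0P.
by move=> _ [x x1 <-]; exact: Mb.
Qed.

Lemma mxpnorm_ge0 m n (M : 'M[C]_(m, n)) : 0 <= nu M.
Proof.
rewrite /mxpnorm; set S := (X in sup X).
have [supS|/sup_out ->//] := pselect (has_sup S).
have [y [x x1 yE]] := supS.1.
apply: le_trans (ub_le_sup supS.2 (ex_intro2 _ _ x x1 yE)).
by rewrite -yE pnorm_ge0.
Qed.

Lemma pnorm_mulmx m n (M : 'M[C]_(m, n)) (x : 'cV[C]_n) :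
  pnorm p (M *m x) <= nu M * pnorm p x.
Proof.
have [x0|x0] := eqVneq (pnorm p x) 0.
  rewrite (pnorm0_eq0 p_ge1 x0) mulmx0 -(scale0r 0) pnormZ// Normc.normc0 mul0r.
  by rewrite mulr_ge0 ?mxpnorm_ge0 ?pnorm_ge0.
have {}x0 : 0 < pnorm p x by rewrite lt_neqAle eq_sym x0 pnorm_ge0.
pose c := real_complex R (pnorm p x)^-1.
have cE : normc c = (pnorm p x)^-1.
  by rewrite normc_real ger0_norm// invr_ge0 ltW.
rewrite -ler_pdivrMr// mulrC -cE -pnormZ// scalemxAr.
apply: ub_le_sup; last by exists (c *: x) => //=; rewrite pnormZ// cE mulVf ?gt_eqF.
exists (\sum_(i < m) \sum_(j < n) normc (M i j)) => _ [y /= y1 <-].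
by apply: le_trans (pnorm_mulmx_le_sum _ _) _; rewrite y1 mulr1.
Qed.

Lemma mxpnorm_le_sum m n (M : 'M[C]_(m, n)) :
  nu M <= \sum_(i < m) \sum_(j < n) normc (M i j).
Proof.
apply: mxpnorm_le => [|x x1].
  by do 2![apply: sumr_ge0 => ? _]; exact: normc_ge0.
by apply: le_trans (pnorm_mulmx_le_sum _ _) _; rewrite x1 mulr1.
Qed.

Lemma mxpnormD m n (M M' : 'M[C]_(m, n)) : nu (M + M') <= nu M + nu M'.
Proof.
apply: mxpnorm_le => [|x x1]; first by rewrite addr_ge0 ?mxpnorm_ge0.
rewrite mulmxDl; apply: le_trans (pnormD p_ge1 _ _) _.
by apply: lerD; apply: le_trans (pnorm_mulmx _ _) _; rewrite x1 mulr1.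
Qed.

Lemma mxpnormM m n k (M : 'M[C]_(m, n)) (M' : 'M[C]_(n, k)) :
  nu (M *m M') <= nu M * nu M'.
Proof.
apply: mxpnorm_le => [|x x1]; first by rewrite mulr_ge0 ?mxpnorm_ge0.
rewrite -mulmxA; apply: le_trans (pnorm_mulmx _ _) _.
rewrite ler_wpM2l ?mxpnorm_ge0//.
by apply: le_trans (pnorm_mulmx _ _) _; rewrite x1 mulr1.
Qed.

Lemma mxpnormZ_le m n c (M : 'M[C]_(m, n)) : nu (c *: M) <= normc c * nu M.
Proof.
apply: mxpnorm_le => [|x x1]; first by rewrite mulr_ge0 ?mxpnorm_ge0 ?normc_ge0.
rewrite -scalemxAl pnormZ// ler_wpM2l ?normc_ge0//.
by apply: le_trans (pnorm_mulmx _ _) _; rewrite x1 mulr1.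
Qed.

Lemma mxpnormZ m n c (M : 'M[C]_(m, n)) : nu (c *: M) = normc c * nu M.
Proof.
apply/eqP; rewrite eq_le mxpnormZ_le/=.
have [->|c0] := eqVneq c 0; first by rewrite Normc.normc0 mul0r mxpnorm_ge0.
rewrite -ler_pdivlMl ?normc_gt0// -Normc.normcV.
by apply: le_trans (mxpnormZ_le _ _); rewrite scalerA mulVf// scale1r.
Qed.

Lemma mxpnorm0 m n : nu (0 : 'M[C]_(m, n)) = 0.
Proof. by rewrite -(scale0r 0) mxpnormZ Normc.normc0 mul0r. Qed.

Lemma mxpnorm1 n : nu (1%:M : 'M[C]_n) <= 1.
Proof. by apply: mxpnorm_le => // x x1; rewrite mul1mx x1. Qed.

Lemma mxpnormX n (M : 'M[C]_n) k : nu (M ^+ k) <= nu M ^+ k.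
Proof.
elim: k => [|k IH]; first by rewrite !expr0; exact: mxpnorm1.
rewrite !exprS; apply: le_trans (mxpnormM _ _) _.
by rewrite ler_wpM2l ?mxpnorm_ge0.
Qed.

Lemma mxpnorm_sum m n I (r : seq I) (P : pred I) (F : I -> 'M[C]_(m, n)) :
  nu (\sum_(i <- r | P i) F i) <= \sum_(i <- r | P i) nu (F i).
Proof.
apply: (big_ind2 (fun z x => nu z <= x)) => //.
  by rewrite mxpnorm0.
by move=> x a y b xa yb; apply: le_trans (lerD xa yb); exact: mxpnormD.
Qed.

Lemma mxpnormN m n (M : 'M[C]_(m, n)) : nu (- M) = nu M.
Proof. by rewrite -scaleN1r mxpnormZ normcN Normc.normc1 mul1r. Qed.

Lemma mxpnormB_dist m n (M M' : 'M[C]_(m, n)) : `|nu M - nu M'| <= nu (M - M').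
Proof.
rewrite ler_norml; apply/andP; split.
  rewrite lerBrDr addrC lerBlDr -(mxpnormN (M - M')) opprB.
  by apply: le_trans (mxpnormD _ _); rewrite [M + _]addrC subrK.
by rewrite lerBlDr; apply: le_trans (mxpnormD _ _); rewrite subrK.
Qed.

End MatrixNorm.
End PNormTheory.

(** * Calculus for complex- and matrix-valued functions of a real variable *)

Section Calculus.
Variable R : realType.
Local Notation C := R[i].
Local Notation normc := (@Normc.normc R).
Local Notation Re := (@complex.Re R).
Local Notation Im := (@complex.Im R).

Definition cderive (f : R -> C) (x : R) (d : C) : Prop :=
  is_derive x 1 (fun y => Re (f y)) (Re d) /\
  is_derive x 1 (fun y => Im (f y)) (Im d).

Lemma cReM (z w : C) : Re (z * w) = Re z * Re w - Im z * Im w.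
Proof. by case: z; case: w. Qed.

Lemma cImM (z w : C) : Im (z * w) = Re z * Im w + Im z * Re w.
Proof. by case: z; case: w. Qed.

Lemma cReD (z w : C) : Re (z + w) = Re z + Re w.
Proof. by case: z; case: w. Qed.

Lemma cImD (z w : C) : Im (z + w) = Im z + Im w.
Proof. by case: z; case: w. Qed.

Lemma cReB (z w : C) : Re (z - w) = Re z - Re w.
Proof. by case: z; case: w. Qed.

Lemma cImB (z w : C) : Im (z - w) = Im z - Im w.
Proof. by case: z; case: w. Qed.

Lemma cRe_affine (z w d : C) (h : R) :
  Re (z - w - real_complex R h * d) = Re z - Re w - h * Re d.
Proof. by case: z w d => [? ?] [? ?] [? ?] /=; ring. Qed.

Lemma cIm_affine (z w d : C) (h : R) :
  Im (z - w - real_complex R h * d) = Im z - Im w - h * Im d.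
Proof. by case: z w d => [? ?] [? ?] [? ?] /=; ring. Qed.

Lemma cderive_cst z x : cderive (fun=> z) x 0.
Proof. by split; exact: is_derive_cst. Qed.

Lemma cderiveD f g x df dg : cderive f x df -> cderive g x dg ->
  cderive (fun y => f y + g y) x (df + dg).
Proof.
move=> [fr fi] [gr gi]; split; rewrite ?cReD ?cImD.
- by under eq_fun do rewrite cReD; exact: is_deriveD.
- by under eq_fun do rewrite cImD; exact: is_deriveD.
Qed.

Lemma cderiveM f g x df dg : cderive f x df -> cderive g x dg ->
  cderive (fun y => f y * g y) x (df * g x + f x * dg).
Proof.
move=> [fr fi] [gr gi]; split; rewrite ?cReD ?cImD.
- under eq_fun do rewrite cReM.
  apply: is_derive_eq; rewrite !cReM /GRing.scale /=; ring.
- under eq_fun do rewrite cImM.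
  apply: is_derive_eq; rewrite !cImM /GRing.scale /=; ring.
Qed.

Lemma cderiveZ z f x df : cderive f x df -> cderive (fun y => z * f y) x (z * df).
Proof.
by move=> f'; have := cderiveM (cderive_cst z x) f'; rewrite mul0r add0r.
Qed.

Lemma cderiveN f x df : cderive f x df -> cderive (fun y => - f y) x (- df).
Proof.
by move=> /(cderiveZ (-1)); rewrite mulN1r; under eq_fun do rewrite mulN1r.
Qed.

Lemma cderiveX f x df k : cderive f x df ->
  cderive (fun y => f y ^+ k) x (k%:R * f x ^+ k.-1 * df).
Proof.
move=> f'; elim: k => [|k IH].
  by under eq_fun do rewrite expr0; rewrite !mul0r; exact: cderive_cst.
under eq_fun do rewrite exprS.
suff -> : k.+1%:R * f x ^+ k.+1.-1 * df =
  df * f x ^+ k + f x * (k%:R * f x ^+ k.-1 * df) by exact: cderiveM.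
by case: k {IH} => [|k] /=; rewrite ?exprS -?natr1; ring.
Qed.

Lemma cderive_sum I (r : seq I) (P : pred I) (f : I -> R -> C) x df :
  (forall i, P i -> cderive (f i) x (df i)) ->
  cderive (fun y => \sum_(i <- r | P i) f i y) x (\sum_(i <- r | P i) df i).
Proof.
move=> f'; elim: r => [|i r IH].
  by under eq_fun do rewrite big_nil; rewrite big_nil; exact: cderive_cst.
under eq_fun do rewrite big_cons; rewrite big_cons.
by case: ifP => [/f' Pi|//]; exact: cderiveD.
Qed.

Lemma cderive_horner (F : {poly C}) f x df : cderive f x df ->
  cderive (fun y => F.[f y]) x (F^`().[f x] * df).
Proof.
move=> f'; elim/poly_ind: F => [|F c IH].
  by under eq_fun do rewrite horner0; rewrite deriv0 horner0 mul0r; exact: cderive_cst.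
under eq_fun do rewrite hornerMXaddC.
rewrite derivMXaddC hornerD hornerMX.
suff -> : (F.[f x] + F^`().[f x] * f x) * df =
  (F^`().[f x] * df * f x + F.[f x] * df) + 0.
  by apply: cderiveD (cderive_cst _ _); exact: cderiveM.
by ring.
Qed.

Lemma cderive_imag x : cderive (fun y => Complex 0 y) x (Complex 0 1).
Proof. by split => /=; [exact: is_derive_cst|exact: is_derive_id]. Qed.

Lemma cderive_real x : cderive (real_complex R) x 1.
Proof. by split => /=; [exact: is_derive_id|exact: is_derive_cst]. Qed.

Definition cis (u : R) : C := Complex (cos u) (sin u).

Lemma cderive_cis x : cderive cis x (Complex 0 1 * cis x).
Proof.
split; rewrite ?cReM ?cImM /= !(mul0r, mul1r, sub0r, add0r).
  exact: is_derive_cos.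
exact: is_derive_sin.
Qed.

Lemma is_derive_linearization (f : R -> R) (x d : R) : is_derive x 1 f d ->
  forall e, 0 < e -> \forall h \near (0 : R), `|f (x + h) - f x - h * d| <= e * `|h|.
Proof.
move=> [df fE] e e0.
have : ((h^-1 *: (f (h *: 1 + x) - f x)) @[h --> (0 : R)^'] --> d)%classic.
  by rewrite -fE; exact: df.
move=> /cvgrPdist_le /(_ e e0); rewrite near_withinE; apply: filterS => h hd.
have [->|h0] := eqVneq h 0.
  by rewrite mul0r subr0 addr0 subrr !normr0 mulr0.
have := hd h0; rewrite -(ler_pM2r (x := `|h|)) ?normr_gt0// -normrM.
congr (_ <= _); rewrite -normrN; congr (`| _ |).
rewrite /GRing.scale /= mulr1 [h + x]addrC.
by field.
Qed.

Lemma cderive_linearization f x d : cderive f x d -> forall e, 0 < e ->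
  \forall h \near (0 : R),
    normc (f (x + h) - f x - real_complex R h * d) <= e * `|h|.
Proof.
move=> [fr fi] e e0; have e20 : 0 < e / 2 by rewrite divr_gt0.
near=> h; apply: le_trans (normc_le_ReIm _) _.
rewrite cRe_affine cIm_affine [e]splitr mulrDl; apply: lerD; near: h.
- exact: (is_derive_linearization fr).
- exact: (is_derive_linearization fi).
Unshelve. all: by end_near. Qed.

Section MatrixValued.
Variables (m n : nat).

Definition mxderive (g : R -> 'M[C]_(m, n)) (x : R) (d : 'M[C]_(m, n)) : Prop :=
  forall i j, cderive (fun y => g y i j) x (d i j).

Lemma mxderiveB f g x df dg : mxderive f x df -> mxderive g x dg ->
  mxderive (fun y => f y - g y) x (df - dg).
Proof.
move=> f' g' i j; rewrite !mxE; under eq_fun do rewrite !mxE.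
by apply: cderiveD (cderiveN _).
Qed.

Lemma mxderiveZl f x df (M : 'M[C]_(m, n)) : cderive f x df ->
  mxderive (fun y => f y *: M) x (df *: M).
Proof.
move=> f' i j; rewrite mxE [df * _]mulrC.
by under eq_fun do rewrite mxE mulrC; exact: cderiveZ.
Qed.

Lemma mxderive_sum I (r : seq I) (P : pred I) (f : I -> R -> 'M[C]_(m, n)) x df :
  (forall i, P i -> mxderive (f i) x (df i)) ->
  mxderive (fun y => \sum_(i <- r | P i) f i y) x (\sum_(i <- r | P i) df i).
Proof.
move=> f' i j; rewrite summxE; under eq_fun do rewrite summxE.
by apply: cderive_sum => k Pk; exact: f'.
Qed.

Variables (p : \bar R) (p_ge1 : (1 <= p)%E).
Local Notation nu := (mxpnorm p).

Lemma mxderive_linearization g x d : mxderive g x d -> forall e, 0 < e ->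
  \forall h \near (0 : R), nu (g (x + h) - g x - real_complex R h *: d) <= e * `|h|.
Proof.
move=> g' e e0; set K : R := (m * n).+1%:R; have K0 : 0 < K by rewrite ltr0n.
have eK0 : 0 < e / K by rewrite divr_gt0.
have : \forall h \near (0 : R), forall ij : 'I_m * 'I_n,
    normc (g (x + h) ij.1 ij.2 - g x ij.1 ij.2 - real_complex R h * d ij.1 ij.2)
    <= e / K * `|h|.
  apply: (@filter_forall R _ (fun (ij : 'I_m * 'I_n) h => is_true
    (normc (g (x + h) ij.1 ij.2 - g x ij.1 ij.2 - real_complex R h * d ij.1 ij.2)
     <= e / K * `|h|)) _ (nbhs_filter (0 : R))) => -[i j].
  exact: (cderive_linearization (g' i j) eK0).
apply: filterS => h hg; apply: le_trans (mxpnorm_le_sum p_ge1 _) _.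
rewrite pair_big /=; apply: (@le_trans _ _ (\sum_(ij : 'I_m * 'I_n) (e / K * `|h|))).
  by apply: ler_sum => ij _; rewrite !mxE; exact: hg.
rewrite sumr_const card_prod !card_ord -mulr_natr.
have -> : e / K * `|h| * (m * n)%:R = e * `|h| * ((m * n)%:R / K) by ring.
by rewrite ler_piMr ?mulr_ge0 ?(ltW e0)// ler_pdivrMr// mul1r ler_nat.
Qed.

(** This replaces the triangle inequality for vector-valued integrals: [phi] is
    a primitive of a bound for the speed of [g].  Take the set of points where
    the inequality from [a] holds with slack [e]; linearising [g] and [phi] at
    its supremum shows that the supremum belongs to the set, and that a larger
    point would too if the supremum were not [b]. *)
Lemma mean_value_inequality g dg (phi dphi : R -> R) (a b : R) : a <= b ->
  (forall x, a <= x <= b -> mxderive g x (dg x)) ->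
  (forall x, a <= x <= b -> is_derive x 1 phi (dphi x)) ->
  (forall x, a <= x <= b -> nu (dg x) <= dphi x) ->
  nu (g b - g a) <= phi b - phi a.
Proof.
move=> ab g' phi' gphi.
suff slack e : 0 < e -> nu (g b - g a) <= phi b - phi a + e * (b - a).
  apply/ler_addgt0Pr => e e0.
  have ba0 : 0 < b - a + 1 by rewrite ltr_wpDl// subr_ge0.
  apply: le_trans (slack (e / (b - a + 1)) _) _; first by rewrite divr_gt0.
  rewrite lerD2l mulrAC ler_pdivrMr// ler_wpM2l ?(ltW e0)//.
  by rewrite lerDl.
move=> e0; have e20 : 0 < e / 2 by rewrite divr_gt0.
have chain N1 N2 x y z X Y Z : N1 <= Z - Y + e * (z - y) ->
    N2 <= Y - X + e * (y - x) -> N1 + N2 <= Z - X + e * (z - x).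
  move=> h1 h2; have -> : Z - X + e * (z - x) =
    (Z - Y + e * (z - y)) + (Y - X + e * (y - x)) by ring.
  exact: lerD.
have loc s : a <= s <= b -> exists2 d, 0 < d & forall h, `|h| < d ->
    nu (g (s + h) - g s) <= Num.sg h * (phi (s + h) - phi s) + e * `|h|.
  move=> sab.
  have : \forall h \near (0 : R),
      nu (g (s + h) - g s) <= Num.sg h * (phi (s + h) - phi s) + e * `|h|.
    have := mxderive_linearization (g' _ sab) e20.
    have := is_derive_linearization (phi' _ sab) e20.
    apply: filterS2 => h; set r := phi _ - _ - _ => hr hg.
    have := mxpnormD p_ge1 (g (s + h) - g s - real_complex R h *: dg s)
       (real_complex R h *: dg s).
    rewrite subrK => /le_trans -> //.
    have -> : phi (s + h) - phi s = r + h * dphi s by rewrite /r subrK.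
    rewrite mulrDr mulrA -normrEsg.
    rewrite mxpnormZ// normc_real.
    have h1 : `|h| * nu (dg s) <= `|h| * dphi s by rewrite ler_wpM2l// gphi.
    have h2 : - (Num.sg h * r) <= e / 2 * `|h|.
      apply: le_trans hr; rewrite -normrN; apply: le_trans (ler_norm _) _.
      rewrite !normrN normrM normr_sg; case: (h != 0); rewrite ?mul1r ?mul0r//.
    by move: (lerD hg h1) h2; clear; lra.
  move=> /nbhs_ballP[d /= d0 dh]; exists d => // h hd; apply: dh.
  by rewrite /ball /= sub0r normrN.
pose T := [set x | a <= x <= b /\ nu (g x - g a) <= phi x - phi a + e * (x - a)]%classic.
have Ta : T a.
  by rewrite /T /= lexx ab !subrr mulr0 addr0 (mxpnorm0 p_ge1).
have hasT : has_sup T.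
  by split; [exists a|exists b => x [/andP[]]].
set s := sup T.
have sab : a <= s <= b.
  apply/andP; split; first exact: (ub_le_sup hasT.2 Ta).
  by apply: ge_sup; [exists a|move=> x [/andP[]]].
have [d d0 hd] := loc _ sab.
have Ts : T s.
  split => //; have [y Ty sy] := sup_adherent d0 hasT.
  have ys : y <= s by apply: ub_le_sup => //; exact: hasT.2.
  rewrite -/s in sy.
  have := hd (y - s); rewrite ler0_norm ?subr_le0// subrKC.
  move=> /(_ ltac:(lra)) hy.
  have [ysE|ysN] := eqVneq y s; first by rewrite -ysE; exact: Ty.2.
  move: hy; rewrite ltr0_sg ?subr_lt0 ?lt_neqAle ?ysN// => hy.
  have := mxpnormD p_ge1 (g s - g y) (g y - g a).
  rewrite addrA subrK => /le_trans; apply.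
  apply: chain Ty.2; rewrite -opprB (mxpnormN p_ge1).
  by move: hy; rewrite mulN1r !opprB.
have [sb|sNb] := eqVneq s b; first by rewrite -sb; exact: Ts.2.
have sb : s < b by rewrite lt_neqAle sNb; case/andP: sab.
set h := Num.min (d / 2) (b - s).
have h0 : 0 < h by rewrite lt_min divr_gt0//= subr_gt0.
have hb : h <= b - s by rewrite ge_min lexx orbT.
have hd2 : h <= d / 2 by rewrite ge_min lexx.
suff /(ub_le_sup hasT.2) : T (s + h) by rewrite -/s gerDl leNgt h0.
split; first by case/andP: sab; lra.
have := hd h; rewrite gtr0_norm// gtr0_sg// mul1r => /(_ ltac:(lra)) hh.
have := mxpnormD p_ge1 (g (s + h) - g s) (g s - g a).
rewrite addrA subrK => /le_trans; apply.
by apply: chain Ts.2; rewrite [s + h - s]addrC addKr.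
Qed.

End MatrixValued.
End Calculus.

(** * Polynomial approximation on a right half disc *)

Section HalfDisc.
Variables (R : realType) (r : R).
Local Notation C := R[i].
Local Notation normc := (@Normc.normc R).
Local Notation Re := (@complex.Re R).

(** Uniform approximation on the right half disc of radius [r].  Polynomials
    have explicit primitives, so for functions approximable in this sense the
    integrals along the half circle and along the diameter agree: this is the
    form in which Cauchy's theorem is used. *)
Definition poly_approximable (f : C -> C) : Prop :=
  forall e : R, 0 < e -> exists F : {poly C},
    forall s, 0 <= Re s -> normc s <= r -> normc (f s - F.[s]) <= e.

Lemma horner_bounded (F : {poly C}) : exists2 M : R, 0 < M &
  forall s, normc s <= r -> normc F.[s] <= M.
Proof.
have [r0|r0] := ltP r 0.
  by exists 1 => // s sr; have := le_lt_trans sr r0; rewrite ltNge normc_ge0.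
elim/poly_ind: F => [|F c [M M0 FM]].
  by exists 1 => // s _; rewrite horner0 Normc.normc0.
exists (M * r + normc c + 1) => [|s sr].
  by rewrite ltr_wpDl// addr_ge0 ?mulr_ge0 ?normc_ge0 ?(ltW M0).
rewrite hornerMXaddC ler_wpDr//; apply: le_trans (le_normcD _ _) _.
rewrite lerD2r Normc.normcM; apply: ler_pM; rewrite ?normc_ge0//.
exact: FM.
Qed.

Lemma poly_approximable_horner F : poly_approximable (horner F).
Proof. by move=> e e0; exists F => s _ _; rewrite subrr Normc.normc0 ltW. Qed.

Lemma poly_approximableM f g : poly_approximable f -> poly_approximable g ->
  poly_approximable (fun s => f s * g s).
Proof.
move=> fa ga e e0; have [F FP] := fa 1 ltr01.
have [M M0 FM] := horner_bounded F.
have M10 : 0 < M + 1 by rewrite addr_gt0.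
have [G GP] := ga (e / 2 / (M + 1)) (divr_gt0 (divr_gt0 e0 (ltr0Sn R 1)) M10).
have [N N0 GN] := horner_bounded G.
have [F' F'P] := fa (e / 2 / N) (divr_gt0 (divr_gt0 e0 (ltr0Sn R 1)) N0).
exists (F' * G) => s s0 sr.
have fM : normc (f s) <= M + 1.
  rewrite -[f s](subrK F.[s]) addrC; apply: le_trans (le_normcD _ _) _.
  by apply: lerD; [exact: FM|exact: FP].
have -> : f s * g s - (F' * G).[s] = f s * (g s - G.[s]) + (f s - F'.[s]) * G.[s].
  by rewrite hornerM; ring.
apply: le_trans (le_normcD _ _) _; rewrite !Normc.normcM [e]splitr.
apply: lerD.
- rewrite -[leRHS](divfK (lt0r_neq0 M10)) mulrC.
  by apply: ler_pM; rewrite ?normc_ge0//; exact: GP.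
- rewrite -[leRHS](divfK (lt0r_neq0 N0)).
  by apply: ler_pM; rewrite ?normc_ge0//; [exact: F'P|exact: GN].
Qed.

(** A disc centred far enough out on the positive real axis contains the half
    disc but not the pole [l], so the geometric series of 1/(s - l) about that
    centre converges uniformly on the half disc. *)
Lemma poly_approximable_pole l : Re l < 0 -> poly_approximable (fun s => (s - l)^-1).
Proof.
move=> l0 e e0.
pose x := - Re l; have x0 : 0 < x by rewrite oppr_gt0.
(* any c with 2 * c * x > r ^+ 2 leaves l outside the disc *)
pose c : R := (r ^+ 2 + 1) / x.
have c0 : 0 < c by rewrite divr_gt0// ltr_wpDl// sqr_ge0.
pose cc := real_complex R c.
(* bounds the square of the ratio of the geometric series *)
pose q2 := (r ^+ 2 + c ^+ 2) / normc (l - cc) ^+ 2.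
have lc : r ^+ 2 + c ^+ 2 < normc (l - cc) ^+ 2.
  rewrite normc_sqr.
  have -> : Re (l - cc) = - (x + c) by rewrite cReB /x /=; ring.
  have cx : c * x = r ^+ 2 + 1 by rewrite divfK// gt_eqF.
  have : 0 <= complex.Im (l - cc) ^+ 2 by rewrite sqr_ge0.
  have : 0 <= x ^+ 2 by rewrite sqr_ge0.
  have : 0 <= r ^+ 2 by rewrite sqr_ge0.
  have -> : (- (x + c)) ^+ 2 = x ^+ 2 + 2 * (c * x) + c ^+ 2 by ring.
  rewrite cx; move: (r ^+ 2) (x ^+ 2) (_ ^+ 2) (c ^+ 2) => a b u v; lra.
have lc0 : 0 < normc (l - cc) ^+ 2.
  by apply: le_lt_trans lc; rewrite addr_ge0 ?sqr_ge0.
have lcN : l - cc != 0.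
  by apply: contraTneq lc0 => ->; rewrite Normc.normc0 expr0n ltxx.
have q20 : 0 <= q2 by rewrite divr_ge0 ?(ltW lc0)// addr_ge0 ?sqr_ge0.
have q21 : q2 < 1 by rewrite ltr_pdivrMr// mul1r.
have ex0 : 0 < (e * x) ^+ 2 by rewrite exprn_gt0// mulr_gt0.
have [k qk] : exists k, q2 ^+ k <= (e * x) ^+ 2.
  have : ((fun k => q2 ^+ k) @ \oo --> (0 : R))%classic by apply: cvg_expr; rewrite ger0_norm.
  move=> /cvgrPdist_le /(_ _ ex0)[k _ /(_ k (leqnn k))] /=.
  by rewrite sub0r normrN ger0_norm ?exprn_ge0//; exists k.
pose Z : {poly C} := (l - cc)^-1 *: ('X - cc%:P).
exists (- (l - cc)^-1 *: \sum_(i < k) Z ^+ i) => s s0 sr.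
pose z := (s - cc) / (l - cc).
have ZE : Z.[s] = z by rewrite /Z hornerZ hornerXsubC mulrC.
have xs : x <= normc (s - l).
  apply: le_trans (Re_le_normc _); apply: le_trans (ler_norm _).
  by rewrite cReB lerDr.
have sl : s - l != 0.
  by apply: contraTneq xs => ->; rewrite Normc.normc0 -ltNge.
have zq : normc z ^+ 2 <= q2.
  rewrite /z /q2 Normc.normcM Normc.normcV exprMn exprVn ler_wpM2r ?invr_ge0 ?(ltW lc0)//.
  apply: le_trans (_ : normc s ^+ 2 + c ^+ 2 <= _); last first.
    by rewrite lerD2r ler_sqr ?nnegrE ?normc_ge0// (le_trans (normc_ge0 s)).
  rewrite !normc_sqr; have : 0 <= Re s * c by rewrite mulr_ge0 ?(ltW c0).
  rewrite cReB cImB /= subr0 sqrrB.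
  move: (Re s * c) (Re s ^+ 2) (complex.Im s ^+ 2) (c ^+ 2) => h a b v; lra.
rewrite hornerZ horner_sum.
under eq_bigr do rewrite horner_exp ZE.
have z1 : 1 - z = (l - s) / (l - cc).
  by rewrite /z -[1](divff lcN) -mulrBl opprB addrA subrK.
have -> : (s - l)^-1 - - (l - cc)^-1 * (\sum_(i < k) z ^+ i) = z ^+ k / (s - l).
  have ls : l - s != 0 by rewrite -opprB oppr_eq0.
  have geo : (1 - z) * (\sum_(i < k) z ^+ i) = 1 - z ^+ k.
    by rewrite -opprB mulNr -subrX1 opprB.
  have -> : \sum_(i < k) z ^+ i = (1 - z ^+ k) / (1 - z).
    by rewrite -geo mulrC mulKf// z1 mulf_neq0// invr_eq0.
  by rewrite z1; field; rewrite sl ls lcN.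
rewrite Normc.normcM normcX Normc.normcV ler_pdivrMr ?(lt_le_trans x0)//.
apply: le_trans (_ : e * x <= _); last by rewrite ler_wpM2l// ltW.
rewrite -ler_sqr ?nnegrE ?exprn_ge0 ?normc_ge0 ?mulr_ge0 ?(ltW e0) ?(ltW x0)//.
rewrite exprAC; apply: le_trans qk.
by apply: lerXn2r => //; rewrite nnegrE ?exprn_ge0 ?normc_ge0.
Qed.

Lemma poly_approximable_ratio (n d : {poly C}) : d != 0 ->
  (forall s, root d s -> Re s < 0) -> poly_approximable (fun s => n.[s] / d.[s]).
Proof.
move=> d0 droot.
have [rs drs] := closed_field_poly_normal d.
have ld0 : lead_coef d != 0 by rewrite lead_coef_eq0.
have rs0 l : l \in rs -> Re l < 0.
  by move=> lrs; apply: droot; rewrite drs rootZ// root_prod_XsubC.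
suff inv_d : poly_approximable (fun s => (d.[s])^-1).
  exact: poly_approximableM (poly_approximable_horner n) inv_d.
rewrite drs; elim: rs rs0 {drs} => [_|l rs IH rs0].
  rewrite big_nil (_ : (fun _ => _) = horner ((lead_coef d)^-1)%:P); last first.
    by apply/funext => s; rewrite !hornerE.
  exact: poly_approximable_horner.
rewrite big_cons; under eq_fun do rewrite scalerAr hornerM hornerXsubC invfM.
apply: poly_approximableM.
- by apply: poly_approximable_pole; apply: rs0; rewrite mem_head.
- by apply: IH => l' l'rs; apply: rs0; rewrite in_cons l'rs orbT.
Qed.

End HalfDisc.

(** * Rational functions in lowest terms *)

Section RationalFunctions.
Variable K : fieldType.
Implicit Types (f : {fraction {poly K}}) (n d : {poly K}).

Lemma ratfun_gcd_neq0 f : ratfun_gcd f != 0.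
Proof. by rewrite /ratfun_gcd gcdp_eq0 negb_and denom_ratioP orbT. Qed.

Lemma ratfun_den_neq0 f : ratfun_den f != 0.
Proof. by rewrite /ratfun_den dvdp_div_eq0 ?dvdp_gcdr// denom_ratioP. Qed.

Lemma ratfun_coprime f : coprimep (ratfun_num f) (ratfun_den f).
Proof. by apply: coprimep_div_gcd; rewrite denom_ratioP orbT. Qed.

Lemma ratfunE f : f = tofrac (ratfun_num f) / tofrac (ratfun_den f).
Proof.
set x := repr f.
have fE : f = tofrac (frac x).1 / tofrac (frac x).2.
  have x20 : tofrac (frac x).2 != 0 by rewrite tofrac_eq0 denom_ratioP.
  apply: (canRL (mulfK x20)); rewrite -[f]reprK -/x.
  rewrite /GRing.mul /= !piE; apply/eqmodP.
  rewrite /= FracField.equivfE /FracField.mulf !numden_Ratio ?mulf_neq0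
    ?denom_ratioP ?oner_neq0//.
  by rewrite !mulr1 mulrC.
have g0 : tofrac (ratfun_gcd f) != 0 by rewrite tofrac_eq0 ratfun_gcd_neq0.
have num : (frac x).1 = ratfun_num f * ratfun_gcd f by rewrite divpK ?dvdp_gcdl.
have den : (frac x).2 = ratfun_den f * ratfun_gcd f by rewrite divpK ?dvdp_gcdr.
rewrite {1}fE num den.
by rewrite !rmorphM /= -mulf_div divff// mulr1.
Qed.

(** Reduction to lowest terms only divides out common factors, so any
    representative whose denominator does not vanish gives the value. *)
Lemma ratfun_eval_frac f n d s : f = tofrac n / tofrac d -> d.[s] != 0 ->
  ratfun_eval f s = n.[s] / d.[s].
Proof.
move=> fE ds; have d0 : d != 0 by apply: contraNneq ds => ->; rewrite horner0.
have cross : ratfun_num f * d = n * ratfun_den f.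
  apply/eqP; rewrite -tofrac_eq !rmorphM /= -eqr_div ?tofrac_eq0 ?ratfun_den_neq0//.
  by rewrite -ratfunE fE.
have dvd : ratfun_den f %| d.
  rewrite -(Gauss_dvdpr _ (_ : coprimep _ (ratfun_num f))) ?cross ?dvdp_mull//.
  by rewrite coprimep_sym ratfun_coprime.
have ds' : (ratfun_den f).[s] != 0.
  apply: contraNneq ds => ds'; move: (dvdpP _ _ dvd) => [u ->].
  by rewrite hornerM ds' mulr0.
have := congr1 (horner^~ s) cross; rewrite /= !hornerM => E.
by apply/eqP; rewrite /ratfun_eval eqr_div// E.
Qed.

End RationalFunctions.

Section Resolvent.
Variables (K : fieldType) (N P Q : nat).
Variables (A : 'M[K]_N) (B : 'M[K]_(N, P)) (C : 'M[K]_(Q, N)).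

Lemma map_char_poly_mx (s : K) :
  map_mx (horner_eval s) (char_poly_mx A) = s%:M - A.
Proof.
apply/matrixP => i j; rewrite !mxE /horner_eval hornerD hornerN hornerC.
by rewrite hornerMn hornerX.
Qed.

Lemma char_poly_horner (s : K) : (char_poly A).[s] = \det (s%:M - A).
Proof. by rewrite -map_char_poly_mx det_map_mx. Qed.

(** Numerator of the transfer matrix over the common denominator
    [char_poly A], by Cramer's rule. *)
Definition resolvent_num : 'M[{poly K}]_(Q, P) :=
  map_mx polyC C *m \adj (char_poly_mx A) *m map_mx polyC B.

Lemma const_ratfun_mxE m n (M : 'M[K]_(m, n)) :
  const_ratfun_mx M = map_mx (@tofrac _) (map_mx polyC M).
Proof. by apply/matrixP => i j; rewrite !mxE. Qed.

Lemma resolvent_fraction i j :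
  (const_ratfun_mx C *m invmx ((tofrac 'X)%:M - const_ratfun_mx A)
    *m const_ratfun_mx B) i j =
  tofrac (resolvent_num i j) / tofrac (char_poly A).
Proof.
have -> : (tofrac 'X)%:M - const_ratfun_mx A = map_mx (@tofrac _) (char_poly_mx A).
  by rewrite /char_poly_mx map_mxB map_scalar_mx -const_ratfun_mxE.
have det0 : \det (map_mx (@tofrac _) (char_poly_mx A)) = tofrac (char_poly A).
  by rewrite det_map_mx.
have ch0 : tofrac (char_poly A) != 0 by rewrite tofrac_eq0 monic_neq0// char_poly_monic.
rewrite /invmx unitmxE det0 unitfE ch0 -map_mx_adj !const_ratfun_mxE.
by rewrite -scalemxAr -scalemxAl -!map_mxM mxE mulrC mxE.
Qed.

Lemma resolvent_num_eval (s : K) : \det (s%:M - A) != 0 ->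
  C *m invmx (s%:M - A) *m B =
  (\det (s%:M - A))^-1 *: map_mx (horner_eval s) resolvent_num.
Proof.
move=> d0; rewrite /invmx unitmxE unitfE d0 /resolvent_num !map_mxM map_mx_adj.
rewrite map_char_poly_mx -scalemxAr -scalemxAl.
have mapC m n (M : 'M[K]_(m, n)) : map_mx (horner_eval s) (map_mx polyC M) = M.
  by apply/matrixP => i j; rewrite !mxE /horner_eval hornerC.
by rewrite !mapC.
Qed.

End Resolvent.

Section Transfer.
Variables (R : realType) (N P Q : nat).
Variables (A : 'M[R]_N) (B : 'M[R]_(N, P)) (C : 'M[R]_(Q, N)).

(** Off the spectrum of A, removing the removable singularities of the rational
    functions does not change the values. *)
Lemma transfer_at_resolvent s : \det (s%:M - complex_mx A) != 0 ->
  transfer_at A B C s = complex_mx C *m invmx (s%:M - complex_mx A) *m complex_mx B.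
Proof.
move=> d0; rewrite resolvent_num_eval//; apply/matrixP => i j.
rewrite [LHS]mxE [RHS]mxE [X in _ * X]mxE /horner_eval /transfer_mx.
rewrite (ratfun_eval_frac (resolvent_fraction _ _ _ i j)) char_poly_horner//.
by rewrite mulrC.
Qed.

End Transfer.

(** * The contour estimate for polynomials of the matrix *)

Section Circle.
Variables (R : realType) (r : R) (r_gt0 : 0 < r).
Local Notation C := R[i].
Local Notation normc := (@Normc.normc R).
Local Notation Re := (@complex.Re R).
Local Notation "''j'" := (Complex 0 1 : C).

Definition circ (u : R) : C := real_complex R r * cis u.
Definition circV (u : R) : C := real_complex R r^-1 * cis (- u).

Lemma normc_cis (u : R) : normc (cis u) = 1.
Proof. by rewrite /cis /= cos2Dsin2 sqrtr1. Qed.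

Lemma normc_circ u : normc (circ u) = r.
Proof. by rewrite /circ Normc.normcM normc_cis normc_real mulr1 gtr0_norm. Qed.

Lemma circM u : circ u * circV u = 1.
Proof.
rewrite /circ /circV mulrACA -rmorphM /= divff ?gt_eqF// rmorph1 mul1r.
rewrite /cis cosN sinN; apply/eqP; rewrite eq_complex /= mulrN opprK mulrN.
by rewrite -!expr2 cos2Dsin2 [sin u * _]mulrC addNr !eqxx.
Qed.

Lemma circ_neq0 u : circ u != 0.
Proof.
apply/eqP => c0; have := circM u; rewrite c0 mul0r => /eqP.
by rewrite eq_sym oner_eq0.
Qed.

Lemma circVE u : circV u = (circ u)^-1.
Proof. by rewrite -[RHS]mul1r -(circM u) mulrAC divff ?circ_neq0// mul1r. Qed.

Lemma Re_circ u : Re (circ u) = r * cos u.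
Proof. by rewrite /circ /cis /= mul0r subr0. Qed.

Lemma circ_pihalf : circ (pi / 2) = Complex 0 r.
Proof.
rewrite /circ /cis cos_pihalf sin_pihalf; apply/eqP.
by rewrite eq_complex /= !(mulr0, mul0r, mulr1, subr0, addr0) !eqxx.
Qed.

Lemma circ_Npihalf : circ (- (pi / 2)) = Complex 0 (- r).
Proof.
rewrite /circ /cis cosN sinN cos_pihalf sin_pihalf; apply/eqP.
by rewrite eq_complex /= !(mulr0, mul0r, mulrN1, subr0, addr0) !eqxx.
Qed.

Lemma circ_periodic u : circ (u + pi *+ 2) = circ u.
Proof. by rewrite /circ /cis cosD2pi sinD2pi. Qed.

Lemma cderive_circ u : cderive circ u ('j * circ u).
Proof. by rewrite /circ mulrCA; apply: cderiveZ; exact: cderive_cis. Qed.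

Lemma cderive_circV u : cderive circV u (- ('j * circV u)).
Proof.
rewrite /circV mulrCA -mulrN; apply: cderiveZ; rewrite /cis cosN sinN.
under eq_fun do rewrite cosN sinN.
split => /=; rewrite !(mul0r, mul1r, sub0r, add0r, opprK).
  exact: is_derive_cos.
by apply: is_deriveN; exact: is_derive_sin.
Qed.

(** Primitive, in the angle u, of 'j s ^ (k - l) at s = circ u.  It is periodic
    unless k = l, which is why only that case contributes to the integral over
    the full circle. *)
Definition angle_prim (k l : nat) (u : R) : C :=
  if k == l then 'j * real_complex R u
  else (k%:R - l%:R)^-1 * (circ u ^+ k * circV u ^+ l).

Lemma cderive_angle_prim k l u :
  cderive (angle_prim k l) u ('j * (circ u ^+ k * circV u ^+ l)).
Proof.
rewrite /angle_prim; have [->|kl] := eqVneq k l.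
  by rewrite -exprMn circM expr1n; apply: cderiveZ; exact: cderive_real.
have kl0 : k%:R - l%:R != 0 :> C by rewrite subr_eq0 eqr_nat.
suff -> : 'j * (circ u ^+ k * circV u ^+ l) = (k%:R - l%:R)^-1 *
   ((k%:R * circ u ^+ k.-1 * ('j * circ u)) * circV u ^+ l +
    circ u ^+ k * (l%:R * circV u ^+ l.-1 * (- ('j * circV u)))).
  apply: cderiveZ; apply: cderiveM; apply: cderiveX.
    exact: cderive_circ.
  exact: cderive_circV.
have predX (x : C) n : n%:R * x ^+ n.-1 * ('j * x) = n%:R * 'j * x ^+ n.
  by case: n => [|n]; rewrite ?mul0r//= exprS; ring.
by rewrite mulrN !predX; field.
Qed.

Lemma angle_prim_turn k l :
  angle_prim k l (pi + pi / 2) - angle_prim k l (- (pi / 2)) =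
  if k == l then 'j * real_complex R (2 * pi) else 0.
Proof.
have piE : pi + pi / 2 = - (pi / 2) + pi *+ 2 :> R by rewrite -mulr_natr; field.
rewrite /angle_prim; case: eqP => _; last first.
  by rewrite !circVE piE circ_periodic subrr.
by rewrite -mulrBr -rmorphB /=; congr (_ * real_complex R _); field.
Qed.

End Circle.

Section PolynomialPrimitive.
Variable K : numFieldType.

Lemma poly_primitive (F : {poly K}) : exists G : {poly K}, G^`() = F.
Proof.
exists (\poly_(k < (size F).+1) (F`_k.-1 / k%:R)); apply/polyP => k.
rewrite coef_deriv coef_poly ltnS; case: ltnP => [_|Fk]; last first.
  by rewrite mul0rn nth_default.
by rewrite -[_ *+ _]mulr_natr divfK// pnatr_eq0.
Qed.

End PolynomialPrimitive.

Section MatrixApproximation.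
Variables (R : realType) (p : \bar R) (p_ge1 : (1 <= p)%E) (m n : nat) (r : R).
Local Notation C := R[i].
Local Notation normc := (@Normc.normc R).
Local Notation nu := (mxpnorm p).

Definition mxhorner (F : 'M[{poly C}]_(m, n)) (s : C) : 'M[C]_(m, n) :=
  \matrix_(i, j) (F i j).[s].

Lemma poly_approximable_mx (H : C -> 'M[C]_(m, n)) :
  (forall i j, poly_approximable r (fun s => H s i j)) ->
  forall e, 0 < e -> exists F : 'M[{poly C}]_(m, n), forall s,
    0 <= complex.Re s -> normc s <= r -> nu (H s - mxhorner F s) <= e.
Proof.
move=> Hij e e0; set K : R := (m * n).+1%:R; have K0 : 0 < K by rewrite ltr0n.
have e'0 : 0 < e / K by rewrite divr_gt0.
have /choice[F FP] (ij : 'I_m * 'I_n) := Hij ij.1 ij.2 _ e'0.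
exists (\matrix_(i, j) F (i, j)) => s s0 sr.
apply: le_trans (mxpnorm_le_sum p_ge1 _) _; rewrite pair_big /=.
apply: (@le_trans _ _ (\sum_(ij : 'I_m * 'I_n) e / K)).
  by apply: ler_sum => -[i j] _; rewrite !mxE; exact: (FP (i, j)).
rewrite sumr_const card_prod !card_ord -mulr_natr mulrAC ler_pdivrMr//.
by rewrite ler_wpM2l ?(ltW e0)// ler_nat.
Qed.

Lemma mxderive_mxhorner (F dF : 'M[{poly C}]_(m, n)) f x df :
  (forall i j, (F i j)^`() = dF i j) -> cderive f x df ->
  mxderive (fun y => mxhorner F (f y)) x (df *: mxhorner dF (f x)).
Proof.
move=> FdF f' i j; rewrite !mxE mulrC -FdF; under eq_fun do rewrite mxE.
exact: cderive_horner.
Qed.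

End MatrixApproximation.

Section Contour.
Variables (R : realType) (p : \bar R) (p_ge1 : (1 <= p)%E) (N P Q : nat).
Local Notation C := R[i].
Local Notation normc := (@Normc.normc R).
Local Notation Re := (@complex.Re R).
Local Notation nu := (mxpnorm p).
Local Notation "''j'" := (Complex 0 1 : C).
Variables (A : 'M[C]_N) (B : 'M[C]_(N, P)) (D : 'M[C]_(Q, N)) (r : R).
Hypothesis r_gtA : nu A < r.

Let r_gt0 : 0 < r. Proof. exact: le_lt_trans (mxpnorm_ge0 p A) r_gtA. Qed.
Let gap_gt0 : 0 < r - nu A. Proof. by rewrite subr_gt0. Qed.

(** Otherwise s would be an eigenvalue, so that r = |s| <= nu A. *)
Lemma resolvent_unit s : normc s = r -> s%:M - A \in unitmx.
Proof.
move=> sr; rewrite -unitmx_tr unitmxE unitfE; apply/negP => /det0P[v v0 vA].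
have {}vA : A *m v^T = s *: v^T.
  apply/eqP; rewrite eq_sym -subr_eq0 -mul_scalar_mx -mulmxBl -trmx_eq0.
  by rewrite trmx_mul trmxK vA.
have nv0 : 0 < pnorm p v^T.
  rewrite lt_neqAle pnorm_ge0 andbT eq_sym; apply: contra v0 => /eqP/pnorm0_eq0.
  by move=> /(_ p_ge1)/eqP; rewrite trmx_eq0.
have := pnorm_mulmx p_ge1 A v^T; rewrite vA pnormZ// sr ler_pM2r//.
by rewrite leNgt r_gtA.
Qed.

(** The resolvent X satisfies s X = 1 + A X; take norms and solve for that
    of X. *)
Lemma resolvent_norm s : normc s = r -> nu (invmx (s%:M - A)) <= (r - nu A)^-1.
Proof.
move=> sr; set X := invmx _.
have sX : s *: X = 1%:M + A *m X.
  rewrite -mul_scalar_mx -[s%:M](subrK A) mulmxDl mulmxV// resolvent_unit//.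
have : nu (s *: X) <= 1 + nu A * nu X.
  rewrite sX; apply: le_trans (mxpnormD p_ge1 _ _) _.
  by apply: lerD; [exact: mxpnorm1|exact: mxpnormM].
rewrite mxpnormZ// sr -lerBlDr -mulrBl => h.
by rewrite -[leRHS]mul1r ler_pdivlMr// mulrC.
Qed.

(** Partial Neumann series of s (s - A)^-1 at s = circ r u; the extra factor s
    comes from ds = 'j s du. *)
Definition neumann (n : nat) (u : R) : 'M[C]_N := \sum_(k < n) circV r u ^+ k *: A ^+ k.

Lemma normc_circV u : normc (circV r u) = r^-1.
Proof. by rewrite circVE// Normc.normcV normc_circ. Qed.

Lemma nu_scaledX u k : nu (circV r u ^+ k *: A ^+ k) <= (nu A / r) ^+ k.
Proof.
rewrite mxpnormZ// normcX normc_circV exprMn mulrC.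
by rewrite ler_wpM2r ?exprn_ge0 ?invr_ge0 ?(ltW r_gt0)// mxpnormX.
Qed.

Lemma neumann_norm n u : nu (neumann n u) <= r / (r - nu A).
Proof.
apply: le_trans (mxpnorm_sum p_ge1 _ _ _) _.
apply: le_trans (ler_sum _ (fun (k : 'I_n) _ => nu_scaledX u k)) _.
have -> : r / (r - nu A) = (1 - nu A / r)^-1.
  by field; rewrite !gt_eqF//.
have k1 : 0 < 1 - nu A / r by rewrite subr_gt0 ltr_pdivrMr// mul1r.
rewrite -[leRHS]mul1r ler_pdivlMr// mulrC -opprB mulNr -subrX1 opprB.
by rewrite gerBl exprn_ge0// divr_ge0 ?mxpnorm_ge0 ?(ltW r_gt0).
Qed.

(** The remainder is explicit: by telescoping,
    (s - A) (neumann n) = s (1 - s^-n A^n). *)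
Lemma neumann_resolvent n u :
  nu (neumann n u - circ r u *: invmx ((circ r u)%:M - A)) <=
    r / (r - nu A) * (nu A / r) ^+ n.
Proof.
set s := circ r u; set X := invmx _.
have sE : s * circV r u = 1 by exact: circM.
have teleE : (s%:M - A) *m neumann n u = s *: (1%:M - circV r u ^+ n *: A ^+ n).
  rewrite /neumann; elim: n => [|n IH].
    by rewrite big_ord0 mulmx0 !expr0 scale1r subrr scaler0.
  rewrite big_ord_recr /= mulmxDr IH mulmxBl mul_scalar_mx -scalemxAr.
  have -> : A *m A ^+ n = A ^+ n.+1 by rewrite exprS.
  have -> : circV r u ^+ n *: A ^+ n.+1 = s *: (circV r u ^+ n.+1 *: A ^+ n.+1).
    by rewrite scalerA [circV r u ^+ n.+1]exprS mulrA sE mul1r.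
  by rewrite -scalerBr -scalerDr addrA subrK.
have U : s%:M - A \in unitmx by rewrite resolvent_unit// normc_circ.
have -> : neumann n u - s *: X = - (s *: (X *m (circV r u ^+ n *: A ^+ n))).
  rewrite -[neumann n u](mulKmx U) teleE -/X -scalemxAr -scalerBr mulmxBr mulmx1.
  by rewrite addrC addKr scalerN.
rewrite mxpnormN// mxpnormZ// normc_circ// -mulrA ler_wpM2l ?(ltW r_gt0)//.
apply: le_trans (mxpnormM p_ge1 _ _) _.
apply: ler_pM; rewrite ?mxpnorm_ge0//; last exact: nu_scaledX.
by rewrite resolvent_norm// normc_circ.
Qed.

Variables (q : {poly C}) (M : R).
Hypothesis q_le : forall s, Re s <= 0 -> normc s <= r -> normc q.[s] <= M.

Let moment k := D *m A ^+ k *m B.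

(** Primitive, in the angle, of the integrand q(s) D (s - A)^-1 B ds of the
    functional calculus with the resolvent truncated at order [n].  After the
    truncation every term is an explicit multiple of a power of s. *)
Definition circle_prim (n : nat) (u : R) : 'M[C]_(Q, P) :=
  \sum_(k < size q) \sum_(l < n) (q`_k * angle_prim r k l u) *: moment l.

Lemma mxderive_circle_prim n u :
  mxderive (circle_prim n) u ('j *: (q.[circ r u] *: (D *m neumann n u *m B))).
Proof.
have -> : 'j *: (q.[circ r u] *: (D *m neumann n u *m B)) =
  \sum_(k < size q) \sum_(l < n)
     (q`_k * ('j * (circ r u ^+ k * circV r u ^+ l))) *: moment l.
  rewrite horner_coef scaler_suml scaler_sumr; apply: eq_bigr => k _.
  rewrite /neumann mulmx_sumr mulmx_suml !scaler_sumr; apply: eq_bigr => l _.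
  by rewrite -scalemxAr -scalemxAl !scalerA; congr (_ *: _); ring.
apply: mxderive_sum => k _; apply: mxderive_sum => l _.
by apply: mxderiveZl; apply: cderiveZ; exact: cderive_angle_prim.
Qed.

(** The residue computation: over a full turn only the terms in s^-1 ds count,
    and up to the factor 2 pi i they add up to D q(A) B. *)
Lemma circle_prim_turn n : (size q <= n)%N ->
  circle_prim n (pi + pi / 2) - circle_prim n (- (pi / 2)) =
  ('j * real_complex R (2 * pi)) *: (D *m (\sum_(k < size q) q`_k *: A ^+ k) *m B).
Proof.
move=> qn; rewrite mulmx_sumr mulmx_suml scaler_sumr /circle_prim -sumrB.
apply: eq_bigr => k _; rewrite -sumrB.
have kn : (k < n)%N := leq_trans (ltn_ord k) qn.
rewrite (bigD1 (Ordinal kn))//= big1 => [|l lk]; last first.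
  rewrite -scalerBl -mulrBr angle_prim_turn// ifF ?mulr0 ?scale0r//.
  by apply: contraNF lk => /eqP kl; apply/eqP/val_inj.
rewrite addr0 -scalerBl -mulrBr (angle_prim_turn r_gt0) eqxx.
by rewrite -scalemxAr -scalemxAl scalerA mulrC.
Qed.

Let arc_bound := M * (nu D * nu B) * (r / (r - nu A)).

(** On the left half circle q is bounded by M, and the truncated resolvent is
    bounded by the geometric series, whatever the order of truncation. *)
Lemma left_arc n : nu (circle_prim n (pi + pi / 2) - circle_prim n (pi / 2)) <=
  pi * arc_bound.
Proof.
have -> : pi * arc_bound = arc_bound * (pi + pi / 2) - arc_bound * (pi / 2).
  by rewrite -mulrBr addrK mulrC.
apply: (mean_value_inequality p_ge1 (phi := fun x => arc_bound * x)
  (dphi := fun=> arc_bound)) => [|x _|x _|x /andP[x1 x2]].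
- by rewrite lerDr ltW// pi_gt0.
- exact: mxderive_circle_prim.
- by apply: is_derive_eq; rewrite /GRing.scale /= mulr1.
- rewrite mxpnormZ// normc_i normr1 mul1r mxpnormZ// /arc_bound -mulrA.
  have Re0 : Re (circ r x) <= 0.
    rewrite Re_circ// mulr_ge0_le0 ?(ltW r_gt0)// -[x](subrK pi) cosDpi oppr_le0.
    by apply: cos_ge0_pihalf; apply/andP; split; lra.
  apply: ler_pM; rewrite ?mxpnorm_ge0 ?normc_ge0//.
    by apply: q_le; rewrite ?normc_circ.
  apply: le_trans (mxpnormM p_ge1 _ _) _.
  apply: le_trans (ler_wpM2r (mxpnorm_ge0 _ _) (mxpnormM p_ge1 _ _)) _.
  by rewrite mulrAC ler_wpM2l ?mulr_ge0 ?mxpnorm_ge0// neumann_norm.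
Qed.

Variable G : C -> 'M[C]_(Q, P).
Hypothesis G_resolvent : forall s, normc s = r -> G s = D *m invmx (s%:M - A) *m B.
Hypothesis G_approx : forall i j, poly_approximable r (fun s => G s i j).

(** On the right half circle the truncated integrand is close to q G ds, hence
    to dF ds for a polynomial dF approximating q G on the half disc.  So the
    primitives of the two integrands increase by almost the same amount. *)
Lemma right_arc (F dF : 'M[{poly C}]_(Q, P)) (e : R) :
  (forall i j, (F i j)^`() = dF i j) ->
  (forall s, 0 <= Re s -> normc s <= r -> nu (q.[s] *: G s - mxhorner dF s) <= e) ->
  0 < e -> exists n, (size q <= n)%N /\
  nu ((circle_prim n (pi / 2) - mxhorner F (Complex 0 r)) -
      (circle_prim n (- (pi / 2)) - mxhorner F (Complex 0 (- r)))) <=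
  pi * (e + r * e).
Proof.
move=> FdF dFe e0.
have [Mr Mr0 q_leMr] := horner_bounded r q.
pose K := Mr * (nu D * nu B * (r / (r - nu A))).
have K0 : 0 <= K.
  by rewrite !mulr_ge0 ?mxpnorm_ge0 ?invr_ge0 ?(ltW Mr0) ?(ltW r_gt0) ?(ltW gap_gt0).
have K10 : 0 < K + 1 by rewrite ltr_wpDl.
have k0 : 0 <= nu A / r by rewrite divr_ge0 ?mxpnorm_ge0 ?(ltW r_gt0).
have k1 : nu A / r < 1 by rewrite ltr_pdivrMr// mul1r.
have [n [qn kn]] : exists n, (size q <= n)%N /\ (nu A / r) ^+ n <= e / (K + 1).
  have : ((fun n => (nu A / r) ^+ n) @ \oo --> (0 : R))%classic.
    by apply: cvg_expr; rewrite ger0_norm.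
  move=> /cvgrPdist_le /(_ _ (divr_gt0 e0 K10))[n _ nP]; exists (n + size q)%N.
  split; first exact: leq_addl.
  have := nP (n + size q)%N (leq_addr _ _).
  by rewrite /= sub0r normrN ger0_norm ?exprn_ge0.
exists n; split => //.
rewrite -circ_pihalf -circ_Npihalf.
pose b := e + r * e.
have -> : pi * (e + r * e) = b * (pi / 2) - b * - (pi / 2) by rewrite /b; field.
apply: (mean_value_inequality p_ge1
  (g := fun u => circle_prim n u - mxhorner F (circ r u))
  (dg := fun u => 'j *: (q.[circ r u] *: (D *m neumann n u *m B)) -
     ('j * circ r u) *: mxhorner dF (circ r u))
  (phi := fun x => b * x) (dphi := fun=> b)) => [|x _|x _|x /andP[x1 x2]].
- by have := pi_ge0 R; lra.
- apply: mxderiveB; first exact: mxderive_circle_prim.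
  by apply: mxderive_mxhorner => //; exact: cderive_circ.
- by apply: is_derive_eq; rewrite /GRing.scale /= mulr1.
- set s := circ r x.
  have sr : normc s = r by rewrite normc_circ.
  have s0 : 0 <= Re s.
    by rewrite Re_circ// mulr_ge0 ?(ltW r_gt0)// cos_ge0_pihalf// x1 x2.
  have -> : 'j *: (q.[s] *: (D *m neumann n x *m B)) - ('j * s) *: mxhorner dF s =
    'j *: (q.[s] *: (D *m (neumann n x - s *: invmx (s%:M - A)) *m B) +
      s *: (q.[s] *: G s - mxhorner dF s)).
    rewrite G_resolvent// mulmxBr mulmxBl -scalemxAr -scalemxAl.
    move: (D *m _ *m B) (D *m _ *m B) (mxhorner dF s) => T W H.
    by apply/matrixP => i j; rewrite !mxE; ring.
  rewrite mxpnormZ// normc_i normr1 mul1r.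
  apply: le_trans (mxpnormD p_ge1 _ _) _; apply: lerD; last first.
    by rewrite mxpnormZ// sr ler_wpM2l ?(ltW r_gt0)// dFe// sr.
  rewrite mxpnormZ//; apply: le_trans (_ : K * (nu A / r) ^+ n <= _).
    rewrite /K -!mulrA; apply: ler_pM; rewrite ?normc_ge0 ?mxpnorm_ge0//.
      by apply: q_leMr; rewrite sr.
    apply: le_trans (mxpnormM p_ge1 _ _) _.
    apply: le_trans (ler_wpM2r (mxpnorm_ge0 _ _) (mxpnormM p_ge1 _ _)) _.
    rewrite -mulrA ler_wpM2l ?mxpnorm_ge0// mulrC ler_wpM2l ?mxpnorm_ge0//.
    by rewrite mulrA neumann_resolvent.
  apply: le_trans (ler_wpM2l K0 kn) _.
  by rewrite mulrCA ler_piMr ?(ltW e0)// ler_pdivrMr// mul1r lerDl.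
Qed.

(** The increment of F between the two ends of the right half circle can also
    be followed along the diameter, where dF is close to q G. *)
Lemma segment (F dF : 'M[{poly C}]_(Q, P)) (phi : R -> R) (e : R) :
  (forall i j, (F i j)^`() = dF i j) ->
  (forall s, 0 <= Re s -> normc s <= r -> nu (q.[s] *: G s - mxhorner dF s) <= e) ->
  (forall x, - r <= x <= r -> is_derive x 1 phi (nu (G (Complex 0 x)))) ->
  nu (mxhorner F (Complex 0 r) - mxhorner F (Complex 0 (- r))) <=
    M * (phi r - phi (- r)) + e * (2 * r).
Proof.
move=> FdF dFe phi'.
have -> : M * (phi r - phi (- r)) + e * (2 * r) =
  (M * phi r + e * r) - (M * phi (- r) + e * - r) by ring.
apply: (mean_value_inequality p_ge1
  (g := fun x => mxhorner F (Complex 0 x))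
  (dg := fun x => 'j *: mxhorner dF (Complex 0 x))
  (phi := fun x => M * phi x + e * x)
  (dphi := fun x => M * nu (G (Complex 0 x)) + e)) => [|x _|x xr|x xr].
- by rewrite ge0_cp ?(ltW r_gt0).
- by apply: mxderive_mxhorner => //; exact: cderive_imag.
- have := phi' _ xr => ?; apply: is_derive_eq; rewrite /GRing.scale /= mulr1.
  by [].
- rewrite mxpnormZ// normc_i normr1 mul1r.
  have xr' : normc (Complex 0 x) <= r by rewrite normc_i ler_norml.
  rewrite -[mxhorner _ _](subrK (q.[Complex 0 x] *: G (Complex 0 x))) addrC.
  apply: le_trans (mxpnormD p_ge1 _ _) _; apply: lerD.
    by rewrite mxpnormZ// ler_wpM2r ?mxpnorm_ge0// q_le.
  by rewrite -mxpnormN// opprB dFe.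
Qed.

(** A full turn of [circle_prim] produces q(A).  It is split into the left half
    circle, the right half circle corrected by F, and the increment of F, which
    is moved to the diameter. *)
Theorem contour_estimate (phi : R -> R) :
  (forall x, - r <= x <= r -> is_derive x 1 phi (nu (G (Complex 0 x)))) ->
  2 * pi * nu (D *m (\sum_(k < size q) q`_k *: A ^+ k) *m B) <=
  M * (phi r - phi (- r)) + pi * (M * (nu D * nu B) * (r / (r - nu A))).
Proof.
move=> phi'; rewrite -/arc_bound; apply/ler_addgt0Pr => e e0.
have pi0 := pi_gt0 R.
have c0 : 0 < pi * (1 + r) + 2 * r by rewrite addr_gt0// mulr_gt0// addr_gt0.
pose d := e / (pi * (1 + r) + 2 * r); have d0 : 0 < d by exact: divr_gt0.
have [dF dFd] : exists dF : 'M[{poly C}]_(Q, P), forall s,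
    0 <= Re s -> normc s <= r -> nu (q.[s] *: G s - mxhorner dF s) <= d.
  apply: (poly_approximable_mx p_ge1 (H := fun s => q.[s] *: G s)) => // i j.
  under eq_fun do rewrite mxE.
  by apply: poly_approximableM => //; exact: poly_approximable_horner.
have /choice[F FdF] (ij : 'I_Q * 'I_P) := poly_primitive (dF ij.1 ij.2).
pose Fm := \matrix_(i, j) F (i, j).
have {}FdF i j : (Fm i j)^`() = dF i j by rewrite mxE FdF.
have [n [qn right]] := right_arc FdF dFd d0.
have seg := segment FdF dFd phi'.
have left := left_arc n.
have turn := circle_prim_turn qn.
have -> : 2 * pi * nu (D *m (\sum_(k < size q) q`_k *: A ^+ k) *m B) =
    nu (circle_prim n (pi + pi / 2) - circle_prim n (- (pi / 2))).
  rewrite turn mxpnormZ// Normc.normcM normc_i normc_real normr1 mul1r.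
  by rewrite gtr0_norm// mulr_gt0.
have -> : circle_prim n (pi + pi / 2) - circle_prim n (- (pi / 2)) =
  (circle_prim n (pi + pi / 2) - circle_prim n (pi / 2)) +
  (((circle_prim n (pi / 2) - mxhorner Fm (Complex 0 r)) -
      (circle_prim n (- (pi / 2)) - mxhorner Fm (Complex 0 (- r)))) +
  (mxhorner Fm (Complex 0 r) - mxhorner Fm (Complex 0 (- r)))).
  move: (circle_prim _ _) (circle_prim _ _) (circle_prim _ _) => x y z.
  move: (mxhorner _ _) (mxhorner _ _) => f f'.
  by apply/matrixP => i j; rewrite !mxE; ring.
apply: le_trans (mxpnormD p_ge1 _ _) _.
apply: le_trans (lerD left (le_trans (mxpnormD p_ge1 _ _) (lerD right seg))) _.
have de : d * (pi * (1 + r) + 2 * r) = e by rewrite divfK// gt_eqF.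
by rewrite -de le_eqVlt; apply/orP; left; apply/eqP; ring.
Qed.

End Contour.

(** * The matrix exponential as the limit of (1 + X / n) ^ n *)

Section ScalarExponential.
Variable R : realType.

Lemma Bernoulli_le (z : R) n : 0 <= z <= 1 -> 1 - n%:R * z <= (1 - z) ^+ n.
Proof.
move=> /andP[z0 z1]; elim: n => [|n IH]; first by rewrite mul0r subr0 expr0.
rewrite exprSr; apply: le_trans (ler_wpM2r _ IH); rewrite ?subr_ge0//.
have : 0 <= n%:R * z ^+ 2 by rewrite mulr_ge0 ?sqr_ge0.
by rewrite -natr1 expr2; move: (n%:R : R) => k h; nra.
Qed.

(** With y = x / n, since 1 - y <= expR (- y), the factor 1 + y is at least
    expR y * (1 - y ^+ 2); Bernoulli's inequality does the rest. *)
Lemma expR_sub_pow_le (x : R) n : 0 <= x -> (0 < n)%N -> x <= n%:R ->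
  expR x - (1 + x / n%:R) ^+ n <= expR x * (x ^+ 2 / n%:R).
Proof.
move=> x0 n0 xn; have n0' : 0 < n%:R :> R by rewrite ltr0n.
set y := x / n%:R.
have y0 : 0 <= y by rewrite divr_ge0 ?(ltW n0').
have y1 : y <= 1 by rewrite ler_pdivrMr// mul1r.
have yx : y *+ n = x by rewrite -mulr_natr divfK// gt_eqF.
have step : expR y * (1 - y ^+ 2) <= 1 + y.
  have : expR y * (1 - y) <= 1.
    have := ler_wpM2l (expR_ge0 y) (expR_ge1Dx (- y)).
    by rewrite -expRD subrr expR0.
  move=> h; have := ler_wpM2r (addr_ge0 ler01 y0) h.
  by rewrite mul1r -mulrA; congr (_ * _ <= _); ring.
have y2 : 0 <= y ^+ 2 <= 1 by rewrite sqr_ge0/= exprn_ile1.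
have : (expR y * (1 - y ^+ 2)) ^+ n <= (1 + y) ^+ n.
  apply: lerXn2r => //; rewrite nnegrE ?addr_ge0//.
  by rewrite mulr_ge0 ?expR_ge0// subr_ge0; case/andP: y2.
rewrite exprMn -expRM_natl mulr_natl yx => pow.
rewrite lerBlDl -lerBlDr; apply: le_trans pow.
rewrite -[X in X - _]mulr1 -mulrBr ler_wpM2l ?expR_ge0//.
apply: le_trans (Bernoulli_le n y2).
rewrite lerD2l lerN2 /y expr_div_n expr2 mulrC le_eqVlt; apply/orP; left.
by apply/eqP; field; rewrite gt_eqF.
Qed.

Lemma exp_partial_sum_le (x : R) m : 0 <= x ->
  \sum_(0 <= k < m) x ^+ k / k`!%:R <= expR x.
Proof.
move=> x0; apply: (nondecreasing_cvgn_le _ (is_cvg_series_exp_coeff x) m).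
apply: nondecreasing_series => k _ _.
by rewrite /exp_coeff /= divr_ge0// exprn_ge0.
Qed.

(** Coefficient of x ^ k in (1 + x / n) ^ n. *)
Definition pow_coef (n k : nat) : R := 'C(n, k)%:R / n%:R ^+ k.

Lemma pow_coef_le n k : pow_coef n k <= (k`!%:R)^-1.
Proof.
have [->|n0] := posnP n.
  rewrite /pow_coef; case: k => [|k]; first by rewrite bin0 fact0 expr0 divr1 invr1.
  by rewrite bin0n mul0r invr_ge0.
rewrite /pow_coef ler_pdivrMr ?exprn_gt0 ?ltr0n//.
rewrite mulrC ler_pdivlMr ?ltr0n ?fact_gt0//.
rewrite -natrM bin_ffact -natrX ler_nat.
elim: k => [|k IH]; first by rewrite ffactn0 expn0.
by rewrite ffactnSr expnSr leq_mul// leq_subr.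
Qed.

Lemma pow_coef_small n k : (n < k)%N -> pow_coef n k = 0.
Proof. by move=> nk; rewrite /pow_coef bin_small// mul0r. Qed.

Lemma big_pow_coef n m (F : nat -> R) : (n < m)%N ->
  \sum_(0 <= k < m) pow_coef n k * F k = \sum_(k < n.+1) pow_coef n k * F k.
Proof.
move=> nm; rewrite (big_cat_nat _ nm)//= [X in _ + X]big_nat_cond.
rewrite [X in _ + X]big1 ?addr0 ?big_mkord// => k; rewrite andbT => /andP[nk _].
by rewrite pow_coef_small// mul0r.
Qed.

Lemma pow_coefE n (x : R) : (0 < n)%N ->
  \sum_(k < n.+1) pow_coef n k * x ^+ k = (1 + x / n%:R) ^+ n.
Proof.
move=> n0; rewrite exprDn; apply: eq_bigr => k _.
by rewrite expr1n mul1r expr_div_n /pow_coef -[RHS]mulr_natl; ring.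
Qed.

End ScalarExponential.

Section MatrixExponential.
Variables (R : realType) (N : nat) (X : 'M[R]_N).

Let K := \sum_(i < N) \sum_(j < N) `|X i j|.

Let K_ge0 : 0 <= K.
Proof. by do 2![apply: sumr_ge0 => ? _]. Qed.

Lemma exprmx_entry_le k i j : `|(X ^+ k) i j| <= K ^+ k.
Proof.
elim: k i j => [|k IH] i j.
  by rewrite !expr0 mxE; case: (_ == _); rewrite ?normr0 ?normr1.
rewrite exprS -[X * _]/(X *m _) mxE.
apply: le_trans (ler_norm_sum _ _ _) _.
apply: (@le_trans _ _ (\sum_(l < N) `|X i l| * K ^+ k)).
  by apply: ler_sum => l _; rewrite normrM ler_wpM2l.
rewrite -mulr_suml exprS ler_wpM2r ?exprn_ge0// /K [leRHS](bigD1 i)//= lerDl.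
by do 2![apply: sumr_ge0 => ? _].
Qed.

(** The limit defining [expmx] is meaningful: entry by entry the series is
    dominated by the scalar exponential series at K. *)
Lemma expmx_cvg :
  (series (fun k : nat => k`!%:R^-1 *: X ^+ k) @ \oo --> expmx X)%classic.
Proof.
set u := series _.
pose c i j k := k`!%:R^-1 * (X ^+ k) i j.
have uE m i j : u m i j = series (c i j) m.
  by rewrite /u /series /= summxE; apply: eq_bigr => k _; rewrite mxE.
have c_cvg i j : cvgn (series (c i j)).
  apply: normed_cvg.
  apply: (series_le_cvg _ _ _ (is_cvg_series_exp_coeff K)) => k /=.
  - by rewrite normr_ge0.
  - by rewrite /exp_coeff /= divr_ge0// exprn_ge0.
  - rewrite /c normrM gtr0_norm ?invr_gt0 ?ltr0n ?fact_gt0// mulrC /exp_coeff /=.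
    by rewrite ler_wpM2r ?invr_ge0// exprmx_entry_le.
suff : (u @ \oo --> \matrix_(i, j) limn (series (c i j)))%classic by move/cvgP.
apply/cvgrPdist_le => e e0.
have : (\forall m \near \oo, forall ij : 'I_N * 'I_N,
    `|limn (series (c ij.1 ij.2)) - series (c ij.1 ij.2) m| <= e)%classic.
  apply: (@filter_forall nat _ (fun (ij : 'I_N * 'I_N) m => is_true
    (`|limn (series (c ij.1 ij.2)) - series (c ij.1 ij.2) m| <= e))) => -[i j].
  by have /cvgrPdist_le /(_ e e0) := c_cvg i j.
apply: filterS => m mP; rewrite [leLHS]mx_normrE.
apply: bigmax_le => [|ij _]; first exact: ltW.
by rewrite !mxE uE; exact: mP.
Qed.

(** The coefficients of (1 + X / n) ^ n are nonnegative and at most those of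
    the exponential series, so the scalar error at K bounds every entry. *)
Lemma expmx_entry_approx n i j : (0 < n)%N -> K <= n%:R ->
  `|expmx X i j - \sum_(k < n.+1) pow_coef R n k * (X ^+ k) i j| <=
    expR K * (K ^+ 2 / n%:R).
Proof.
move=> n0 Kn; apply: le_trans (expR_sub_pow_le K_ge0 n0 Kn).
apply/ler_addgt0Pr => e e0.
have : ((fun m => series (fun k : nat => k`!%:R^-1 *: X ^+ k) m i j) @ \oo
    --> expmx X i j)%classic.
  apply: (cvg_comp _ (fun M : 'M[R]_N => M i j) expmx_cvg).
  exact: (@coord_continuous R N N i j (expmx X)).
move=> /cvgrPdist_le /(_ e e0)[m0 _ m0P].
pose m := maxn m0 n.+1.
have := m0P m (leq_maxl _ _); rewrite /=.
have -> : series (fun k : nat => k`!%:R^-1 *: X ^+ k) m i j =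
    \sum_(0 <= k < m) k`!%:R^-1 * (X ^+ k) i j.
  by rewrite /series /= summxE; apply: eq_bigr => k _; rewrite mxE.
set S := \sum_(0 <= k < m) _ => eS.
rewrite -(subrKA S) [leRHS]addrC; apply: le_trans (ler_normD _ _) _.
apply: lerD; first exact: eS.
have nm : (n < m)%N by rewrite leq_maxr.
have /= <- := big_pow_coef (fun k => (X ^+ k) i j) nm.
rewrite -(pow_coefE _ n0) -(big_pow_coef (GRing.exp K) nm) /S -sumrB.
apply: le_trans (ler_norm_sum _ _ _) _.
apply: (@le_trans _ _ (\sum_(0 <= k < m) ((k`!%:R)^-1 - pow_coef R n k) * K ^+ k)).
  apply: ler_sum => k _; rewrite -mulrBl normrM ger0_norm ?subr_ge0 ?pow_coef_le//.
  by rewrite ler_wpM2l ?subr_ge0 ?pow_coef_le// exprmx_entry_le.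
under eq_bigr do rewrite mulrBl.
rewrite sumrB lerD2r; under eq_bigr do rewrite mulrC.
exact: exp_partial_sum_le.
Qed.

End MatrixExponential.

(** * The transfer matrix on the imaginary axis *)

Section ImaginaryAxis.
Variable R : realType.
Local Notation C := R[i].

(** A uniform limit of polynomials is continuous. *)
Lemma continuous_mxpnorm_imag (p : \bar R) m n (G : C -> 'M[C]_(m, n)) :
  (1 <= p)%E -> (forall r i j, poly_approximable r (fun s => G s i j)) ->
  continuous (fun w => mxpnorm p (G (Complex 0 w))).
Proof.
move=> p_ge1 G_approx x; apply/cvgrPdist_le => e e0.
have e30 : 0 < e / 3 by rewrite divr_gt0.
have [F FG] := poly_approximable_mx p_ge1 (G_approx (`|x| + 1)) e30.
pose Fi w := mxhorner F (Complex 0 w).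
have FGi w : `|w| <= `|x| + 1 -> mxpnorm p (G (Complex 0 w) - Fi w) <= e / 3.
  by move=> wx; apply: FG; rewrite ?normc_i.
set D := Complex 0 1 *: mxhorner (\matrix_(i, j) (F i j)^`()) (Complex 0 x).
have F' : mxderive Fi x D.
  by apply: mxderive_mxhorner => [i j|]; [rewrite mxE|exact: cderive_imag].
have nD : 0 < mxpnorm p D + 1 by rewrite ltr_wpDl ?mxpnorm_ge0.
have [d /= d0 dF] : exists2 d, 0 < d & forall h, `|h| < d ->
    mxpnorm p (Fi (x + h) - Fi x) <= `|h| * (mxpnorm p D + 1).
  have /nbhs_ballP[d /= d0 dh] := mxderive_linearization p_ge1 F' ltr01.
  exists d => // h hd.
  have /dh /= Fh : ball (0 : R) d h by rewrite /ball /= sub0r normrN.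
  rewrite -(subrK (real_complex R h *: D) (_ - _)).
  apply: le_trans (mxpnormD p_ge1 _ _) _.
  by rewrite mxpnormZ// normc_real mulrDr mulr1 addrC lerD2l -[`|h|]mul1r.
have : 0 < Num.min (Num.min d 1) (e / 3 / (mxpnorm p D + 1)).
  by rewrite !lt_min d0 ltr01 divr_gt0.
set dd := Num.min _ _ => dd0; near=> y.
have : `|y - x| < dd by near: y; apply: cvgr_distC_lt.
rewrite !lt_min => /andP[/andP[yd y1] yD].
apply: le_trans (mxpnormB_dist p_ge1 _ _) _.
have -> : G (Complex 0 x) - G (Complex 0 y) =
  (G (Complex 0 x) - Fi x) - (G (Complex 0 y) - Fi y) - (Fi (x + (y - x)) - Fi x).
  by rewrite subrKC; apply/matrixP => i j; rewrite !mxE; ring.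
apply: le_trans (mxpnormD p_ge1 _ _) _.
apply: le_trans (lerD (mxpnormD p_ge1 _ _) (lexx _)) _.
rewrite !(mxpnormN p_ge1).
have -> : e = e / 3 + e / 3 + e / 3 by field.
apply: lerD; first apply: lerD.
- by apply: FGi; rewrite lerDl.
- apply: FGi; rewrite -[y](subrKC x); apply: le_trans (ler_normD _ _) _.
  by rewrite lerD2l ltW.
- apply: le_trans (dF _ yd) _.
  by rewrite -ler_pdivlMr// ltW.
Unshelve. all: by end_near. Qed.

(** The base point lies to the left of [- r] so that the primitive is
    differentiable on both sides at the ends of the segment. *)
Lemma continuous_primitive (h : R -> R) (r : R) : continuous h -> 0 <= r ->
  exists phi : R -> R,
    (forall x, - r - 1 < x -> is_derive x 1 phi (h x)) /\
    phi r - phi (- r) = \int[lebesgue_measure]_(w in `[- r, r]) h w.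
Proof.
move=> hc r0.
have int (a b : R) : lebesgue_measure.-integrable `[a, b]%classic (EFin \o h).
  apply: continuous_compact_integrable; first exact: segment_compact.
  by apply: continuous_subspaceT => x; exact: hc.
exists (fun x => \int[lebesgue_measure]_(w in `[- r - 1, x]) h w); split.
  move=> x rx; have x1 : x < x + 1 by rewrite ltrDl.
  have [F' FE] := continuous_FTC1_closed x1 (int (- r - 1) (x + 1)) rx (hc x).
  split; first exact: F'.
  by move: FE; rewrite derive1E.
rewrite Rintegral_itvB//.
- rewrite Rintegral_itv_obnd_cbnd//.
  by apply: integrableS (int (- r) r) => //; exact: subset_itv_oc_cc.
- by rewrite bnd_simp gerBl.
- by rewrite bnd_simp ge0_cp.
Qed.

(** This is where stability enters: the denominators have no root in the
    closed right half plane. *)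
Lemma transfer_at_approx N P Q (A : 'M[R]_N) (B : 'M[R]_(N, P)) (D : 'M[R]_(Q, N)) r i j :
  io_stable A B D -> poly_approximable r (fun s => transfer_at A B D s i j).
Proof.
move=> stable; under eq_fun do rewrite mxE.
apply: poly_approximable_ratio; first exact: ratfun_den_neq0.
by move=> s sroot; apply: stable; exists i, j.
Qed.

End ImaginaryAxis.

(** * The estimate for the matrix exponential *)

Section EulerPolynomial.
Variables (R : realType) (t : R).
Local Notation C := R[i].
Local Notation normc := (@Normc.normc R).

(** The polynomial (1 + t s / n) ^ n in s. *)
Definition euler_poly (n : nat) : {poly C} :=
  \poly_(k < n.+1) real_complex R (pow_coef R n k * t ^+ k).

Lemma euler_poly_horner n s : (0 < n)%N ->
  (euler_poly n).[s] = (1 + real_complex R (t / n%:R) * s) ^+ n.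
Proof.
move=> n0; rewrite horner_poly exprDn; apply: eq_bigr => k _.
rewrite expr1n mul1r exprMn -mulr_natl /pow_coef !rmorphM /= !rmorphXn /=.
by rewrite !fmorphV /= !rmorphXn /= !rmorph_nat expr_div_n; ring.
Qed.

(** In the closed left half plane the real part of t s / n is nonpositive, so
    only the squared term contributes to the modulus of 1 + t s / n. *)
Lemma euler_poly_le n (r : R) s : 0 <= t -> (0 < n)%N ->
  complex.Re s <= 0 -> normc s <= r ->
  normc (euler_poly n).[s] <= expR ((t * r) ^+ 2 / n%:R).
Proof.
move=> t0 n0 s0 sr; rewrite euler_poly_horner// normcX.
have n0' : 0 < n%:R :> R by rewrite ltr0n.
set c := t / n%:R; have c0 : 0 <= c by rewrite divr_ge0.
set z := 1 + _.
have z2 : normc z ^+ 2 <= expR ((c * r) ^+ 2).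
  apply: le_trans (expR_ge1Dx _).
  have sr2 : normc s ^+ 2 <= r ^+ 2.
    by rewrite ler_sqr ?nnegrE ?normc_ge0// (le_trans (normc_ge0 s)).
  rewrite normc_sqr /z cReD cImD cReM cImM /= !(mul0r, subr0, addr0, add0r).
  have : 0 <= c * - complex.Re s by rewrite mulr_ge0 ?oppr_ge0.
  have := ler_wpM2l (sqr_ge0 c) sr2; rewrite normc_sqr.
  have -> : (1 + c * complex.Re s) ^+ 2 + (c * complex.Im s) ^+ 2 =
    1 - 2 * (c * - complex.Re s) + c ^+ 2 * (complex.Re s ^+ 2 + complex.Im s ^+ 2) by ring.
  rewrite [(c * r) ^+ 2]exprMn; move: (c * - complex.Re s) (c ^+ 2 * r ^+ 2) => x w.
  move: (c ^+ 2 * (complex.Re s ^+ 2 + _)) => y; lra.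
have E1 : 1 <= expR ((t * r) ^+ 2 / n%:R) by rewrite leNgt expR_lt1 -leNgt divr_ge0 ?sqr_ge0.
have E2 : (normc z ^+ n) ^+ 2 <= expR ((t * r) ^+ 2 / n%:R).
  have -> : (t * r) ^+ 2 / n%:R = n%:R * (c * r) ^+ 2.
    by rewrite /c; field; rewrite gt_eqF.
  by rewrite expRM_natl exprAC; apply: lerXn2r => //; rewrite nnegrE ?sqr_ge0 ?expR_ge0.
rewrite -ler_sqr ?nnegrE ?exprn_ge0 ?normc_ge0 ?expR_ge0//.
apply: le_trans E2 _; rewrite expr2 ler_peMr// ?expR_ge0//.
Qed.

End EulerPolynomial.

Section SemigroupEstimate.
Variables (R : realType) (N P Q : nat).
Variables (A : 'M[R]_N) (B : 'M[R]_(N, P)) (D : 'M[R]_(Q, N)).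
Variables (p : \bar R) (p_ge1 : (1 <= p)%E).
Local Notation C := R[i].
Local Notation nu := (mxpnorm p).

Lemma complex_mxM m n k (M : 'M[R]_(m, n)) (M' : 'M[R]_(n, k)) :
  complex_mx (M *m M') = complex_mx M *m complex_mx M'.
Proof. exact: map_mxM. Qed.

Lemma complex_mxX (M : 'M[R]_N) k : complex_mx (M ^+ k) = complex_mx M ^+ k.
Proof.
elim: k => [|k IH]; first by rewrite !expr0 /complex_mx map_mx1.
by rewrite !exprS -IH; exact: complex_mxM.
Qed.

Lemma scalemxX (t : R) (M : 'M[R]_N) k : (t *: M) ^+ k = t ^+ k *: M ^+ k.
Proof.
elim: k => [|k IH]; first by rewrite !expr0 scale1r.
rewrite !exprS IH -[LHS]/(_ *m _) -scalemxAl -scalemxAr scalerA.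
by [].
Qed.

Lemma complex_euler_poly t n :
  complex_mx (\sum_(k < n.+1) pow_coef R n k *: (t *: A) ^+ k) =
  \sum_(k < size (euler_poly t n)) (euler_poly t n)`_k *: complex_mx A ^+ k.
Proof.
transitivity (\sum_(k < n.+1) (euler_poly t n)`_k *: complex_mx A ^+ k).
  apply/matrixP => i j; rewrite mxE !summxE rmorph_sum; apply: eq_bigr => k _.
  by rewrite scalemxX scalerA coef_poly ltn_ord -complex_mxX !mxE rmorphM.
rewrite (big_ord_widen _ (fun k => (euler_poly t n)`_k *: complex_mx A ^+ k) (size_poly _ _)).
rewrite [RHS]big_mkcond; apply: eq_bigr => k _; case: ltnP => // sk.
by rewrite nth_default// scale0r.
Qed.

Lemma complex_expmx_approx t n : let K := \sum_(i < N) \sum_(j < N) `|(t *: A) i j| in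
  (0 < n)%N -> K <= n%:R ->
  nu (complex_mx (expmx (t *: A)) -
      \sum_(k < size (euler_poly t n)) (euler_poly t n)`_k *: complex_mx A ^+ k)
  <= (N * N)%:R * (expR K * K ^+ 2) / n%:R.
Proof.
move=> K n0 Kn; rewrite -complex_euler_poly.
apply: le_trans (mxpnorm_le_sum p_ge1 _) _.
rewrite pair_big /=; apply: (@le_trans _ _ (\sum_(ij : 'I_N * 'I_N)
   (expR K * (K ^+ 2 / n%:R)))).
  apply: ler_sum => -[i j] _ /=; rewrite [X in Normc.normc X]mxE.
  rewrite [X in _ + X]mxE ![complex_mx _ _ _]mxE -rmorphB normc_real.
  rewrite summxE; under eq_bigr do rewrite mxE.
  exact: expmx_entry_approx.
by rewrite sumr_const card_prod !card_ord -[_ *+ _]mulr_natl !mulrA.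
Qed.

Hypothesis stable : io_stable A B D.
Local Notation h := (fun w => nu (transfer_at A B D (Complex 0 w))).
Variables (t : R) (t_ge0 : 0 <= t).

(** The polynomials (1 + t s / n) ^ n are bounded on the left half disc by
    constants tending to 1, and their values at A tend to the exponential of
    t A: the contour estimate passes to the limit. *)
Lemma semigroup_estimate (r : R) (phi : R -> R) : nu (complex_mx A) < r ->
  (forall x, - r <= x <= r -> is_derive x 1 phi (h x)) ->
  2 * pi * nu (complex_mx (D *m expmx (t *: A) *m B)) <=
  phi r - phi (- r) +
    pi * (nu (complex_mx D) * nu (complex_mx B) * (r / (r - nu (complex_mx A)))).
Proof.
move=> rA phi'.
set W := nu (complex_mx D) * nu (complex_mx B).
have W0 : 0 <= W by rewrite mulr_ge0 ?mxpnorm_ge0.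
set L := _ + pi * _.
pose K := \sum_(i < N) \sum_(j < N) `|(t *: A) i j|.
pose c := 2 * pi * (W * ((N * N)%:R * (expR K * K ^+ 2))).
pose f n := expR ((t * r) ^+ 2 * n.+1%:R^-1) * L + c * n.+1%:R^-1.
have harm : ((fun n : nat => (n.+1%:R^-1 : R)) @ \oo --> (0 : R))%classic.
  exact: cvg_harmonic.
have : (f @ \oo --> expR ((t * r) ^+ 2 * 0) * L + c * 0)%classic.
  apply: cvgD; last by apply: cvgM => //; exact: cvg_cst.
  apply: cvgM; last exact: cvg_cst.
  apply: continuous_cvg; first exact: continuous_expR.
  by apply: cvgM => //; exact: cvg_cst.
rewrite !mulr0 expR0 mul1r addr0 => f_cvg.
apply: (ler_cvg_to (cvg_cst _) f_cvg).
near=> n.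
have Kn : K <= n.+1%:R.
  near: n; exists (Num.truncn K).+1 => // n /= Kn.
  by rewrite (le_trans (ltW (truncnS_gt K)))// ler_nat ltnW.
have := @contour_estimate R p p_ge1 N P Q (complex_mx A) (complex_mx B) (complex_mx D)
  r rA (euler_poly t n.+1) (expR ((t * r) ^+ 2 / n.+1%:R))
  (fun s s0 sr => euler_poly_le t_ge0 (ltn0Sn n) s0 sr) (transfer_at A B D) _ _ phi phi'.
set S := \sum_(k < _) _ => est.
have {}est : 2 * pi * nu (complex_mx D *m S *m complex_mx B) <=
    expR ((t * r) ^+ 2 / n.+1%:R) * L.
  apply: le_trans (est _ _) _.
  - move=> s sr; apply: transfer_at_resolvent.
    by have := resolvent_unit p_ge1 rA sr; rewrite unitmxE unitfE.
  - by move=> i j; exact: transfer_at_approx.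
  - by rewrite /L -/W le_eqVlt; apply/orP; left; apply/eqP; ring.
have diff := complex_expmx_approx (ltn0Sn n) Kn; rewrite -/S in diff.
have -> : complex_mx (D *m expmx (t *: A) *m B) = complex_mx D *m S *m complex_mx B +
   complex_mx D *m (complex_mx (expmx (t *: A)) - S) *m complex_mx B.
  by rewrite -mulmxDl -mulmxDr subrKC !complex_mxM.
have pi0 : 0 <= 2 * pi :> R by rewrite mulr_ge0// pi_ge0.
apply: le_trans (ler_wpM2l pi0 (mxpnormD p_ge1 _ _)) _.
rewrite mulrDr; apply: lerD; first exact: est.
have -> : c * n.+1%:R^-1 =
    2 * pi * (W * ((N * N)%:R * (expR K * K ^+ 2) / n.+1%:R)) by rewrite /c; ring.
rewrite ler_wpM2l//; apply: le_trans (mxpnormM p_ge1 _ _) _.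
apply: le_trans (ler_wpM2r (mxpnorm_ge0 _ _) (mxpnormM p_ge1 _ _)) _.
by rewrite mulrAC ler_wpM2l.
Unshelve. all: by end_near. Qed.

End SemigroupEstimate.

Theorem theorem5 (R : realType) (N P Q : nat)
    (A : 'M[R]_N) (B : 'M[R]_(N, P)) (C : 'M[R]_(Q, N))
    (stable : io_stable A B C)
    (p : \bar R) (p_ge1 : (1 <= p)%E)
    (a : R) (a_gt1 : 1 < a)
    (r : R) (rE : r = a * mxpnorm p (complex_mx A))
    (t : R) (t_ge0 : 0 <= t) :
  mxpnorm p (complex_mx (C *m expmx (t *: A) *m B)) <=
    (2 * pi)^-1 *
      \int[lebesgue_measure]_(w in `[- r, r])
        mxpnorm p (transfer_at A B C (Complex 0 w))
    + mxpnorm p (complex_mx C) * mxpnorm p (complex_mx B) / (2 - 2 * a^-1).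
Proof.
set h := fun w => mxpnorm p (transfer_at A B C (Complex 0 w)).
set alpha := mxpnorm p (complex_mx A) in rE.
set W := mxpnorm p (complex_mx C) * _; set Y := mxpnorm p (complex_mx _).
have W0 : 0 <= W by rewrite mulr_ge0 ?mxpnorm_ge0.
have a0 : 0 < a := lt_trans ltr01 a_gt1.
have alpha0 : 0 <= alpha := mxpnorm_ge0 _ _.
have r0 : 0 <= r by rewrite rE mulr_ge0// ltW.
have pi2 : 0 < 2 * pi :> R by rewrite mulr_gt0// pi_gt0.
have h_cont : continuous h.
  apply: (continuous_mxpnorm_imag (G := transfer_at A B C)) => // ? ? ?.
  exact: transfer_at_approx.
have [phi [phi' <-]] := continuous_primitive h_cont r0.
have est := semigroup_estimate p_ge1 stable t_ge0.
have [alpha_eq0|alphaN0] := eqVneq alpha 0; last first.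
  have alpha_gt0 : 0 < alpha by rewrite lt_neqAle eq_sym alphaN0.
  have ar : alpha < r by rewrite rE ltr_pMl.
  have phi_r x : - r <= x <= r -> is_derive x 1 phi (h x).
    by move=> /andP[rx _]; apply: phi'; rewrite (lt_le_trans _ rx)// ltrBlDr ltrDl.
  have := est r phi ar phi_r; rewrite -/Y -/W -/alpha.
  rewrite -ler_pdivlMl// mulrDr => /le_trans; apply; rewrite lerD2l.
  rewrite le_eqVlt; apply/orP; left; apply/eqP; rewrite rE.
  move: (pi_gt0 R); move: (pi : R) => u u0; field.
  rewrite !gt_eqF ?subr_gt0 ?ltr_pMl//.
  by rewrite -[ltLHS]mulr1 ltr_pM2l.
have r_eq0 : r = 0 by rewrite rE alpha_eq0 mulr0.
(* no circle of radius r surrounds the spectrum; any radius rho > 0 does, and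
   only the half circle term survives as rho tends to 0 *)
have half : W / 2 <= W / (2 - 2 * a^-1).
  rewrite ler_wpM2l// lef_pV2 ?posrE//.
    by rewrite gerBl mulr_ge0// invr_ge0 ltW.
  by rewrite subr_gt0 -[ltRHS]mulr1 ltr_pM2l// invf_lt1.
have small : 2 * pi * Y <= pi * W.
  apply/ler_addgt0Pr => e e0.
  have phi0 : is_derive (0 : R) 1 phi (h 0).
    by apply: phi'; rewrite r_eq0 oppr0 sub0r oppr_lt0.
  have h10 : 0 < `|h 0| + 1 by rewrite ltr_wpDl.
  have /nbhs_ballP[d /= d0 phid] := is_derive_linearization phi0 ltr01.
  pose rho := Num.min (Num.min (d / 2) (2^-1)) (e / (2 * (`|h 0| + 1))).
  have rho0 : 0 < rho by rewrite !lt_min !divr_gt0 ?mulr_gt0 ?invr_gt0 ?ltr0n.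
  have rho1 : rho <= 2^-1 by rewrite !ge_min lexx orbT.
  have rhod : rho <= d / 2 by rewrite !ge_min lexx.
  have rhoe : rho * (2 * (`|h 0| + 1)) <= e.
    by rewrite -ler_pdivlMr ?mulr_gt0// !ge_min lexx !orbT.
  have arho : alpha < rho by rewrite alpha_eq0.
  have phi_rho x : - rho <= x <= rho -> is_derive x 1 phi (h x).
    move=> /andP[x1 _]; apply: phi'; rewrite r_eq0 oppr0 sub0r.
    by apply: lt_le_trans x1; rewrite ltrN2 (le_lt_trans rho1)// invf_lt1// ltr1n.
  have := est rho phi arho phi_rho; rewrite -/Y -/W -/alpha alpha_eq0 subr0.
  rewrite (divff (lt0r_neq0 rho0)) mulr1 => /le_trans; apply.
  rewrite addrC lerD2l; apply: le_trans rhoe.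
  have step u : `|u| = rho -> `|phi u - phi 0| <= rho * (`|h 0| + 1).
    move=> ur; have /phid /= : ball (0 : R) d u.
      by rewrite /ball /= sub0r normrN ur (le_lt_trans rhod)// gtr_pMr// invf_lt1// ltr1n.
    rewrite add0r ur mul1r => lin.
    rewrite -(subrK (u * h 0) (_ - _)); apply: le_trans (ler_normD _ _) _.
    by rewrite normrM ur mulrDr mulr1 addrC lerD2l.
  have := step rho (gtr0_norm rho0); have := step (- rho).
  rewrite normrN gtr0_norm// => /(_ erefl).
  rewrite !ler_norml => /andP[h1 h2] /andP[h3 h4]; move: h1 h2 h3 h4; clear; lra.
rewrite r_eq0 oppr0 subrr mulr0 add0r; apply: le_trans half.
rewrite ler_pdivlMr// -(ler_pM2l (pi_gt0 R)); apply: le_trans small.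
by rewrite le_eqVlt; apply/orP; left; apply/eqP; ring.
Qed.
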